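(* Let $K\subset\mathbb{R}^n$ be a convex body in Behrend position. Then \[ \operatorname{idq}(K)\ \ge\ \mathrm{DR}\!\left(\tbinom{n+1}{2},n,n\right)\ \ge\ \frac{\left(\frac{n+1}{2}\right)^{n/2}}{\binom{n(n+1)/2}{n}^{1/2}\,n!}, \] and, as $n\to\infty$, \[ \frac{\left(\frac{n+1}{2}\right)^{n/2}}{\binom{n(n+1)/2}{n}^{1/2}\,n!}\ \sim\ \sqrt{e}\left(\frac{2\pi}{n}\right)^{1/4}\frac{\sqrt{n+1}}{n!\,e^{n/2}}. \] In particular, for every convex body $K\subset\mathbb{R}^3$ in Behrend position, $\operatorname{idq}(K)\ge\sqrt{10}/30$.
   Context: A convex body in $\mathbb{R}^n$ is a compact convex set with nonempty interior. $\mathrm{D}(K)=\max\{\|x-y\|:x,y\in K\}$ is the Euclidean diameter, $\mathrm{vol}$ the $n$-dimensional volume, and $\operatorname{idq}(K)=\mathrm{vol}(K)/\mathrm{D}(K)^n$. A convex body $K$ is in Behrend position if $\operatorname{idq}(K)=\max_{A\in \mathrm{GL}_n(\mathbb{R})}\operatorname{idq}(AK)$. For integers $1\le j\le n\le m$, $\mathrm{DR}(m,n,j)$ denotes the largest number $\nu\ge 0$ such that for all unit vectors $u_1,\dots,u_m\in\mathbb{S}^{n-1}\subset\mathbb{R}^n$ and all scalars $\lambda_1,\dots,\lambda_m\ge 0$ with $\mathrm{I}_n=\sum_{i=1}^m\lambda_i u_iu_i^{\intercal}$ ($\mathrm{I}_n$ the $n\times n$ identity matrix) there exist indices $1\le i_1<\dots<i_j\le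 m$ with $\mathrm{vol}_j(\operatorname{conv}\{0,u_{i_1},\dots,u_{i_j}\})\ge\nu$, where $\mathrm{vol}_j$ is $j$-dimensional volume. The notation $f(n)\sim g(n)$ means $\lim_{n\to\infty}f(n)/g(n)=1$. *)

(* Defs.v *)
From HB Require Import structures.
From mathcomp Require Import all_boot all_order all_algebra.
From mathcomp Require Import all_classical all_reals all_analysis.

Set Implicit Arguments.
Unset Strict Implicit.
Unset Printing Implicit Defensive.

Import Order.TTheory GRing.Theory Num.Theory.
Import numFieldNormedType.Exports.

Local Open Scope classical_set_scope.
Local Open Scope ring_scope.

(* n-dimensional Lebesgue measure on n.-tuple R: the product measure of n copies
   of the one-dimensional Lebesgue measure, transported at each step along the
   isomorphism (x, t) |-> x :: t. *)
Section lebesgue_tuple.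
Context {R : realType}.

Definition tuple_cons n (p : measurableTypeR R * n.-tuple (measurableTypeR R)) :
  n.+1.-tuple (measurableTypeR R) := [the n.+1.-tuple _ of p.1 :: p.2].

Definition tuple_uncons n (t : n.+1.-tuple (measurableTypeR R)) :
  measurableTypeR R * n.-tuple (measurableTypeR R) :=
  (thead t, [tuple of behead t]).

Lemma tuple_consK n : cancel (@tuple_cons n) (@tuple_uncons n).
Proof. by move=> [x t]; congr pair; exact/val_inj. Qed.

Lemma tuple_unconsK n : cancel (@tuple_uncons n) (@tuple_cons n).
Proof. by move=> t; rewrite [RHS]tuple_eta; exact/val_inj. Qed.

Lemma measurable_tuple_cons n : measurable_fun setT (@tuple_cons n).
Proof. exact: measurable_cons. Qed.

Lemma measurable_tuple_uncons n : measurable_fun setT (@tuple_uncons n).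
Proof.
apply/measurable_fun_pair; first exact: measurable_tnth.
exact: measurable_behead.
Qed.

Section step.
Variables (n : nat)
  (mu : {sigma_finite_measure set (n.-tuple (measurableTypeR R)) -> \bar R}).

Definition lebesgue_step :=
  pushforward (lebesgue_measure \x mu)%E (@tuple_cons n).

Let lebesgue_step0 : lebesgue_step set0 = 0%E.
Proof. by rewrite /lebesgue_step /pushforward preimage_set0 measure0. Qed.

Let lebesgue_step_ge0 A : (0 <= lebesgue_step A)%E.
Proof. by rewrite /lebesgue_step /pushforward measure_ge0. Qed.

Let lebesgue_step_sigma_additive : semi_sigma_additive lebesgue_step.
Proof.
move=> F mF tF mUF; rewrite /lebesgue_step /pushforward preimage_bigcup.
apply: measure_semi_sigma_additive.
- by move=> k; rewrite -[X in measurable X]setTI; exact: measurable_tuple_cons.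
- apply/trivIsetP => /= i j _ _ ij; rewrite -preimage_setI.
  by move/trivIsetP : tF => /(_ _ _ _ _ ij) ->//; rewrite preimage_set0.
- rewrite -preimage_bigcup -[X in measurable X]setTI.
  exact: measurable_tuple_cons.
Qed.

HB.instance Definition _ := isMeasure.Build _ _ _ lebesgue_step
  lebesgue_step0 lebesgue_step_ge0 lebesgue_step_sigma_additive.

Lemma lebesgue_step_sigma_finite : sigma_finite setT lebesgue_step.
Proof.
have /sigma_finiteP[F [TF ndF Foo]] :=
  sigma_finiteT (@lebesgue_measure R : {sigma_finite_measure set _ -> \bar R}).
have /sigma_finiteP[G [TG ndG Goo]] := sigma_finiteT mu.
exists (fun k => @tuple_uncons n @^-1` (F k `*` G k)).
  rewrite -preimage_bigcup [X in _ @^-1` X](_ : _ = setT) ?preimage_setT//.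
  rewrite -setXTT TF TG predeqE => -[x y]; split.
    by move=> [/= k _ []/= ? ?]; split; exists k.
  move=> [/= [k _ Fkx] [l _ Gly]]; exists (maxn k l) => //; split.
  - by move: x Fkx; exact/subsetPset/ndF/leq_maxl.
  - by move: y Gly; exact/subsetPset/ndG/leq_maxr.
move=> k; have [mF Fk] := Foo k; have [mG Gk] := Goo k; split.
  rewrite -[X in measurable X]setTI.
  by apply: measurable_tuple_uncons => //; exact: measurableX.
rewrite /lebesgue_step/= /pushforward.
rewrite [X in (_ \x _)%E X](_ : _ = F k `*` G k); last first.
  rewrite -comp_preimage (_ : _ \o _ = id) ?preimage_id//.
  by apply/funext => p; exact: tuple_consK.
by rewrite product_measure1E// lte_mul_pinfty// ge0_fin_numE.
Qed.

HB.instance Definition _ :=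
  Measure_isSigmaFinite.Build _ _ _ lebesgue_step lebesgue_step_sigma_finite.

End step.

Fixpoint lebesgue_tuple n :
    {sigma_finite_measure set (n.-tuple (measurableTypeR R)) -> \bar R} :=
  match n with
  | 0 => \d_[tuple]
  | m.+1 => lebesgue_step (lebesgue_tuple m)
  end.

(* Sanity check: the measure of a box. *)
Lemma lebesgue_tuple_box n (A : 'I_n -> set (measurableTypeR R)) :
  (forall i, measurable (A i)) ->
  (lebesgue_tuple n [set t | forall i, A i (tnth t i)] =
   \prod_(i < n) lebesgue_measure (A i))%E.
Proof.
elim: n A => [|n IH] A mA.
  rewrite big_ord0 (_ : [set t | _] = setT) /= ?diracT//.
  by apply/seteqP; split => // t _ [].
rewrite big_ord_recl -IH//= /lebesgue_step /pushforward -product_measure1E//.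
  congr (product_measure1 _ _ _); apply/seteqP; split => -[x t] /=.
    move=> At; split; first exact: (At ord0).
    by move=> i; have := At (lift ord0 i); rewrite tnthS.
  move=> [A0 At] i; case: (unliftP ord0 i) => [j ->|->//].
  by rewrite tnthS; exact: At.
rewrite (_ : [set t | _] = \big[setI/setT]_(i < n)
    ((fun t => tnth t i) @^-1` A (lift ord0 i))).
  apply: bigsetI_measurable => i _; rewrite -[X in measurable X]setTI.
  exact: measurable_tnth.
apply/seteqP; split => t /=.
  by move=> At; rewrite -bigcap_seq => i _; exact: At.
by rewrite -bigcap_seq => At i; apply: At => /=; rewrite mem_index_enum.
Qed.

End lebesgue_tuple.

Section convex_bodies.
Context {R : realType}.

(* Only used for Borel sets of finite measure (in fact compact sets). *)
Definition vol n (K : set 'rV[R]_n) : R :=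
  fine (lebesgue_tuple n [set t | K (\row_i tnth t i)]).

(* The norm of the library on 'rV[R]_n is the sup norm, hence this one. *)
Definition enorm n (x : 'rV[R]_n) : R := Num.sqrt (\sum_i x 0 i ^+ 2).

Definition diam n (K : set 'rV[R]_n) : R :=
  sup [set enorm (x - y) | x in K & y in K].

Definition convex_body n (K : set 'rV[R]_n) :=
  [/\ compact K, convex_set K & K° !=set0].

Definition idq n (K : set 'rV[R]_n) : R := vol K / diam K ^+ n.

(* Points are row vectors, so matrices act on the right. *)
Definition linear_image n (A : 'M[R]_n) (K : set 'rV[R]_n) : set 'rV[R]_n :=
  [set x *m A | x in K].

(* idq K is itself one of the values idq (linear_image A K), namely for A = 1,
   so being an upper bound of these values means being their maximum. *)
Definition behrend_position n (K : set 'rV[R]_n) :=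
  forall A : 'M[R]_n, A \in unitmx -> idq (linear_image A K) <= idq K.

Definition conv_hull n (S : set 'rV[R]_n) : set 'rV[R]_n :=
  smallest (@convex_set R 'rV[R]_n) S.

(* j-dimensional volume of a set S contained in a j-dimensional linear subspace
   of R^n: the Lebesgue measure of S read in coordinates with respect to an
   orthonormal family E of j vectors whose span contains S. It does not depend
   on E: the supremum is over a single value. *)
Definition vol_sub j n (S : set 'rV[R]_n) : R :=
  sup [set vol [set y : 'rV[R]_j | S (y *m E)] |
    E in [set E : 'M[R]_(j, n) |
            E *m E^T = 1%:M /\ S `<=` range (fun y => y *m E)]].

(* The largest nu, as a supremum. For 1 <= j <= n <= m it is attained: the set is
   nonempty and bounded, and it is closed because there are finitely many f. *)
Definition DR (m n j : nat) : R :=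
  sup [set nu : R | 0 <= nu /\
    forall (u : 'I_m -> 'rV[R]_n) (lambda : 'I_m -> R),
      (forall i, enorm (u i) = 1) -> (forall i, 0 <= lambda i) ->
      1%:M = \sum_i lambda i *: ((u i)^T *m u i) ->
      exists2 f : 'I_j -> 'I_m, {homo f : a b / (a < b)%N} &
        nu <= vol_sub j (conv_hull ([set 0] `|` range (u \o f)))].

Definition idq_lower_bound (n : nat) : R :=
  (n.+1%:R / 2) `^ (n%:R / 2) /
  (Num.sqrt 'C((n * n.+1) %/ 2, n)%:R * n`!%:R).

Definition idq_lower_bound_asymptotic (n : nat) : R :=
  Num.sqrt (expR 1) * (2 * pi / n%:R) `^ (1 / 4) *
  (Num.sqrt n.+1%:R / (n`!%:R * expR (n%:R / 2))).

End convex_bodies.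

Arguments DR : clear implicits.
Arguments idq_lower_bound : clear implicits.
Arguments idq_lower_bound_asymptotic : clear implicits.

(* Main.v *)
(* If K is in Behrend position, then the identity lies in the cone generated by the
   matrices d^T d, where d runs over the vectors x - y (x, y in K) of maximal length.
   Otherwise let H <> 0 be the difference between the identity and a nearest point
   of the cone. By first order optimality, tr H >= <H, H> > 0 while d H d^T <= 0 for
   all these d; hence a small perturbation 1 + e H (corrected by a multiple of 1)
   increases the volume of K without increasing its diameter. By Caratheodory's
   theorem binom(n+1, 2) of the matrices d^T d suffice, which gives unit vectors u_i
   with 1 = sum_i l_i u_i^T u_i such that K contains a segment of length diam K in
   each of the directions u_i. A convex body containing segments of the form
   [a_i, a_i + w_i], i < n, has volume at least |det w| / n! (compare it with a cone,
   one direction at a time), so idq K is at least the volume of any of the simplices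
   conv {0, u_(i_1), ..., u_(i_n)}.

   The Cauchy-Binet formula writes 1 = det (sum_i l_i u_i^T u_i) as the sum of the
   squared n-minors of u with weights prod l_i. As sum_i l_i = n, the total weight is
   bounded by Maclaurin's inequality, and some minor is large.

   The asymptotic equivalence follows from Stirling's formula (obtained here from
   Wallis' product) and prod_(i < n) (1 - i / binom(n+1, 2)) --> exp (-1). *)
Require Import Defs.
From mathcomp Require Import all_boot all_order all_algebra all_fingroup finmap.
From mathcomp Require Import all_classical all_reals all_analysis.
From mathcomp Require Import measurable_realfun lra ring.

Set Implicit Arguments.
Unset Strict Implicit.
Unset Printing Implicit Defensive.

Import Order.TTheory GRing.Theory Num.Theory.
Import numFieldNormedType.Exports.

Local Open Scope ring_scope.

(** * Large minors of a decomposition of the identity *)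

(* The Cauchy-Binet formula, summed over all maps instead of the n-subsets, hence
   the factor n!. *)
Lemma det_sum_outer (F : comPzRingType) n N (u : 'I_N -> 'rV[F]_n) (l : 'I_N -> F) :
  n`!%:R * \det (\sum_k l k *: ((u k)^T *m u k)) =
  \sum_(f : {ffun 'I_n -> 'I_N})
    (\prod_i l (f i)) * \det (\matrix_i u (f i)) ^+ 2.
Proof.
(* Row [i] of the sum is the combination of the vectors [u k] with weights [l k * u k 0 i]. By
   multilinearity [g f] is the term that takes the vector [u (f i)] in row [i]. *)
pose g (f : {ffun 'I_n -> 'I_N}) : F :=
  (\prod_i l (f i)) * (\prod_i u (f i) 0 i) * \det (\matrix_i u (f i)).
have detE : \det (\sum_k l k *: ((u k)^T *m u k)) = \sum_f g f.
  rewrite /determinant.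
  under eq_bigr => s _.
    under eq_bigr => i _.
      rewrite summxE; under eq_bigr => k _ do rewrite !mxE big_ord1 !mxE.
      over.
    rewrite bigA_distr_bigA /= mulr_sumr; over.
  rewrite exchange_big /=; apply: eq_bigr => f _.
  rewrite /g /determinant mulr_sumr; apply: eq_bigr => s _.
  rewrite !big_split /=; set a := \prod_i l _; set b := \prod_i u _ _ _.
  rewrite [RHS]mulrCA !mulrA; congr (_ * _); apply: eq_bigr => i _.
  by rewrite mxE.
(* Averaging over permutations of the arguments of [f] collects the diagonal products of entries
   into a second copy of the determinant. *)
have gperm (t : 'S_n) :
    \sum_f g f = \sum_(f : {ffun 'I_n -> 'I_N}) g [ffun i => f (t i)].
  rewrite (reindex (fun f : {ffun 'I_n -> 'I_N} => [ffun i => f (t i)])) //.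
  exists (fun f : {ffun 'I_n -> 'I_N} => [ffun i => f (t^-1%g i)]) => f _;
    by apply/ffunP => i; rewrite !ffunE ?permK ?permKV.
rewrite detE -[n in n`!]card_ord -card_Sn ?card_ord mulr_natl -sumr_const.
under eq_bigr => t _ do rewrite (gperm t).
rewrite exchange_big /=; apply: eq_bigr => f _.
have -> : \det (\matrix_i u (f i)) ^+ 2 =
    \sum_(t : 'S_n) (-1) ^+ t * (\prod_i u (f i) 0 (t^-1%g i)) *
      \det (\matrix_i u (f i)).
  rewrite expr2 {1}/determinant mulr_suml (reindex_inj invg_inj) /=.
  by apply: eq_bigr => t _; rewrite odd_permV; congr (_ * _ * _);
    apply: eq_bigr => i _; rewrite mxE.
rewrite mulr_sumr; apply: eq_big => [t|t _]; first by rewrite inE.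
have -> : g [ffun i => f (t i)] = (\prod_i l (f (t i))) * (\prod_i u (f (t i)) 0 i) *
   \det (row_perm t (\matrix_i u (f i))).
  rewrite /g; congr (_ * _ * _); try by apply: eq_bigr => i _; rewrite ffunE.
  congr (\det _).
  by apply/matrixP => i j; rewrite !mxE ffunE.
rewrite row_permE det_mulmx det_perm mulrA -!mulrA; congr (_ * _).
  by rewrite [RHS](reindex_inj (@perm_inj _ t)).
rewrite mulrCA; congr (_ * (_ * _)).
by rewrite [RHS](reindex_inj (@perm_inj _ t)); apply: eq_bigr => i _; rewrite permK.
Qed.

(** The product depends only on the image of [f], and each [n]-subset is the image of n! injective
    maps. *)
Lemma sum_prod_injective (F : comPzSemiRingType) n N (l : 'I_N -> F) :
  \sum_(f : {ffun 'I_n -> 'I_N} | injectiveb f) \prod_i l (f i) =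
  n`!%:R * \sum_(A : {set 'I_N} | #|A| == n) \prod_(i in A) l i.
Proof.
rewrite (partition_big (fun f : {ffun 'I_n -> 'I_N} => f @: [set: 'I_n])
  (fun A : {set 'I_N} => #|A| == n)) /=; last first.
  by move=> f /injectiveP fi; rewrite card_imset // finset.cardsT card_ord.
rewrite mulr_sumr; apply: eq_bigr => A /eqP An.
rewrite (eq_bigr (fun=> \prod_(i in A) l i)); last first.
  move=> f /andP[/injectiveP fi /eqP <-]; rewrite big_imset /=.
    by apply: eq_bigl => i; rewrite inE.
  by move=> ? ? _ _; exact: fi.
rewrite sumr_const mulr_natl; congr (_ *+ _).
have -> : n`! = #|A| ^_ #|'I_n| by rewrite An card_ord ffactnn.
rewrite -card_inj_ffuns_on; apply: eq_card => f; rewrite !inE.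
apply/andP/andP => -[] => [fi /eqP fA|fA fi]; split => //.
  by apply/ffun_onP => i; rewrite -fA imset_f.
rewrite eqEcard card_imset; last exact/injectiveP.
rewrite cardsT card_ord An leqnn andbT.
by apply/fintype.subsetP => _ /imsetP[i _ ->]; exact: (ffun_onP fA).
Qed.

(** Reading elementary symmetric polynomials as coefficients turns the addition of a variable into
    the multiplication by a linear factor, which suits induction on [N]. *)
Lemma sum_prod_coef (F : comNzRingType) n N (l : 'I_N -> F) :
  \sum_(A : {set 'I_N} | #|A| == n) \prod_(i in A) l i =
  (\prod_(i < N) (l i *: 'X + 1))`_n.
Proof.
rewrite bigA_distr coef_sum big_mkcond; apply: eq_bigr => A _.
have -> : \prod_i (if i \in A then l i *: 'X else 1) =
    (\prod_(i in A) l i) *: 'X^(#|A|).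
  rewrite -big_mkcond scaler_prod prodr_const.
  by [].
by rewrite coefZ coefXn eq_sym; case: eqP => _; rewrite ?mulr1 ?mulr0.
Qed.

(** Bernoulli's inequality for [d / a], multiplied by a power of [a] so that [a = 0] is allowed. *)
Lemma bernoulli_scaled (R : realFieldType) (a d : R) n : 0 <= a -> 0 <= a + d ->
  a ^+ n * (a + n.+1%:R * d) <= (a + d) ^+ n.+1.
Proof.
move=> a0 ad; elim: n => [|n IH]; first by rewrite expr0 !mul1r.
have := ler_wpM2r ad IH; rewrite -exprSr; apply: le_trans.
have := exprn_ge0 n a0; rewrite exprSr -subr_ge0.
rewrite [X in _ -> _ <= X](_ : _ = a ^+ n * (n.+1%:R * d ^+ 2)).
  by move=> an; apply: mulr_ge0 => //; apply: mulr_ge0; rewrite ?ler0n ?sqr_ge0.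
by rewrite -(natr1 n.+1); ring.
Qed.

(** Induction on the number of variables: with a new variable x, e_(n+1) becomes e_(n+1) + x e_n,
    and both terms are bounded through the mean of the old variables. *)
Lemma maclaurin (R : realFieldType) n N (l : 'I_N -> R) : (forall i, 0 <= l i) ->
  \sum_(A : {set 'I_N} | #|A| == n) \prod_(i in A) l i <=
  'C(N, n)%:R * ((\sum_i l i) / N%:R) ^+ n.
Proof.
move=> l0; rewrite sum_prod_coef.
elim: N n l l0 => [|N IH] n l l0.
  by rewrite !big_ord0 coef1 mul0r expr0n; case: n => [|n];
    rewrite ?bin0 ?bin0n ?mul1r // mulr0.
rewrite !big_ord_recr /=; set P := \prod_(i < N) _; set s := \sum_(i < N) _.
have s0 : 0 <= s by apply: sumr_ge0.
case: n => [|n].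
  rewrite mulrDr mulr1 coefD -scalerAr coefZ coefMX /= mulr0 add0r.
  by rewrite (le_trans (IH 0 _ _)) // !bin0 !expr0.
rewrite mulrDr mulr1 coefD -scalerAr coefZ coefMX /=.
set x := l ord_max; have x0 : 0 <= x by exact: l0.
have lN i : 0 <= l (widen_ord (leqnSn N) i) by exact: l0.
have := IH n.+1 _ lN; rewrite -/P -/s => I1.
have := IH n _ lN; rewrite -/P -/s => /(ler_wpM2l x0) I2.
apply: le_trans (lerD I2 I1) _.
(* Recorded before [l] is forgotten: for [N = 0] there is no old mean, and this case is treated
   apart. *)
have sN : N = 0%N -> s = 0.
  by move=> N0; rewrite /s big1 // => i; have := ltn_ord i; rewrite {2}N0.
clear I1 I2 IH P lN; clearbody s x => {l l0}.
case: N s s0 sN => [|N] s s0 sN.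
  rewrite sN // !mul0r !add0r divr1 expr0n.
  case: n => [|n] /=.
    by rewrite bin0 binn !mul1r expr1 mulr1 addr0.
  by rewrite !(mulr0, addr0) mulr_ge0 ?ler0n ?exprn_ge0.
set a := s / N.+1%:R; have a0 : 0 <= a by rewrite divr_ge0.
pose d := (x - a) / N.+2%:R.
(* The mean moves from [a] to [a + d] when [x] is added; what remains to be shown is
   Bernoulli's inequality for [d / a], cleared of denominators. *)
have N1 : N.+1%:R != 0 :> R by rewrite pnatr_eq0.
have N2 : N.+2%:R != 0 :> R by rewrite pnatr_eq0.
have aN : s = a * N.+1%:R by rewrite /a divfK.
have adE : a + d = (s + x) / N.+2%:R.
  by rewrite /d aN -(natr1 N.+1); field; rewrite (addrC 1) !natr1 pnatr_eq0.
have ad : 0 <= a + d by rewrite adE divr_ge0 // addr_ge0.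
have := bernoulli_scaled n a0 ad; rewrite adE => /(ler_wpM2l (ler0n R 'C(N.+2, n.+1))).
apply: le_trans; rewrite le_eqVlt; apply/orP; left; apply/eqP.
have H1 : (N.+2%:R * 'C(N.+1, n)%:R = n.+1%:R * 'C(N.+2, n.+1)%:R :> R).
  by rewrite -!natrM mul_bin_diag.
have H2 : ('C(N.+1, n.+1)%:R = 'C(N.+2, n.+1)%:R - 'C(N.+1, n)%:R :> R).
  by rewrite (binS N.+1) natrD addrK.
have H3 : ('C(N.+1, n)%:R = n.+1%:R * 'C(N.+2, n.+1)%:R / N.+2%:R :> R).
  by rewrite -H1 mulrC mulKf.
rewrite H2 H3 /d exprS; move: N2 (a ^+ n) => N2 y; field.
by rewrite -natrD pnatr_eq0.
Qed.

(** Maps with a repeated value give minors with two equal rows, so Cauchy-Binet writes n! as a sum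
    over injective maps. The map with the largest squared minor satisfies the bound, as the total
    weight is controlled by Maclaurin's inequality. *)
Lemma exists_large_minor (R : realFieldType) n N (u : 'I_N -> 'rV[R]_n)
    (l : 'I_N -> R) :
  (forall i, 0 <= l i) -> 1%:M = \sum_k l k *: ((u k)^T *m u k) ->
  exists2 f : 'I_n -> 'I_N, injective f &
    1 <= 'C(N, n)%:R * ((\sum_k l k) / N%:R) ^+ n *
         \det (\matrix_i u (f i)) ^+ 2.
Proof.
move=> l0 I1; pose h (f : {ffun 'I_n -> 'I_N}) := \det (\matrix_i u (f i)) ^+ 2.
have fact0 : 0 < n`!%:R :> R by rewrite ltr0n fact_gt0.
have : n`!%:R = \sum_(f : {ffun 'I_n -> 'I_N} | injectiveb f) (\prod_i l (f i)) * h f.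
  transitivity (n`!%:R * \det (\sum_k l k *: ((u k)^T *m u k))).
    by rewrite -I1 det1 mulr1.
  rewrite det_sum_outer (bigID (fun f : {ffun 'I_n -> 'I_N} => injectiveb f)) /=.
  rewrite [X in _ + X]big1 ?addr0 // => f /injectivePn[i [j ij fij]].
  rewrite (@determinant_alternate _ _ _ i j) ?expr0n ?mulr0 // => k.
  by rewrite !mxE fij.
have [f0 /= f0i nE|noinj] := pickP (fun f : {ffun 'I_n -> 'I_N} => injectiveb f);
  last by rewrite big_pred0 // => /eqP; rewrite gt_eqF.
case: (@arg_maxP _ _ _ f0 (fun f => injectiveb f) h f0i) => f /injectiveP fi fmax; exists f => //.
rewrite -(ler_pM2l fact0) mulr1 {1}nE.
apply: (@le_trans _ _
  (\sum_(g : {ffun 'I_n -> 'I_N} | injectiveb g) (\prod_i l (g i)) * h f)).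
  by apply: ler_sum => g gi; apply: ler_wpM2l; [exact: prodr_ge0|exact: (fmax _ gi)].
rewrite -mulr_suml sum_prod_injective -[leLHS]mulrA ler_pM2l //.
by apply: ler_wpM2r; [exact: sqr_ge0|exact: maclaurin].
Qed.

(** * Nearest points in a cone of matrices d^T d *)

(** This is the number of free entries of a symmetric matrix; there are [j + 1] such pairs with
    second component [j]. *)
Lemma card_le_pairs n : #|[set p : 'I_n * 'I_n | p.1 <= p.2]%N| = 'C(n.+1, 2).
Proof.
rewrite -bin2_sum big_mkord big_ord_recl /= add0n -sum1_card.
rewrite (eq_bigl (fun p : 'I_n * 'I_n => true && (p.1 <= p.2)%N)); last first.
  by move=> p; rewrite inE.
rewrite -(pair_big_dep xpredT (fun i j : 'I_n => (i <= j)%N) (fun _ _ => 1%N)) /=.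
rewrite (exchange_big_dep xpredT) //=; apply: eq_bigr => j _.
rewrite -(big_ord_widen n (fun=> 1%N) (ltn_ord j)) sum1_card card_ord /bump /=.
by rewrite add1n.
Qed.

Section cone_combinations.
Context {R : realFieldType}.

Definition outer_sum n m (c : 'I_m -> R) (d : 'I_m -> 'rV[R]_n) : 'M[R]_n :=
  \sum_i c i *: ((d i)^T *m d i).

(** There is one matrix more than the dimension of the symmetric matrices. Listing the entries on
    and above the diagonal as rows of [G] gives a matrix with more rows than columns, hence a
    nontrivial relation between its rows. *)
Lemma outer_dependent n (d : 'I_('C(n.+1, 2)).+1 -> 'rV[R]_n) :
  exists2 a : 'I_('C(n.+1, 2)).+1 -> R, outer_sum a d = 0 & exists i, 0 < a i.
Proof.
pose P := [set p : 'I_n * 'I_n | p.1 <= p.2]%N.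
have cP : #|P| = 'C(n.+1, 2) := card_le_pairs n.
pose G : 'M[R]_(('C(n.+1, 2)).+1, #|P|) :=
  \matrix_(i, j) (d i 0 (enum_val j).1 * d i 0 (enum_val j).2).
have kG : kermx G != 0.
  by rewrite -mxrank_eq0 mxrank_ker subn_eq0 -ltnNge (leq_ltn_trans (rank_leq_col G)) // cP.
have [k0 [i0 a0]] : exists k i, kermx G k i != 0.
  have /rowV0Pn[v /submxP[w ->] v0] := kG.
  have [k kn0] : exists k, row k (kermx G) != 0.
    apply/existsP; apply: contraNT v0; rewrite negb_exists => /forallP H.
    rewrite mulmx_sum_row big1 // => k _; have := H k; rewrite negbK => /eqP ->.
    by rewrite scaler0.
  have /rV0Pn[i ki] := kn0; exists k, i.
  by move: ki; rewrite mxE.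
pose a i := kermx G k0 i.
have aG : outer_sum a d = 0.
  have aP p : p \in P -> \sum_i a i * (d i 0 p.1 * d i 0 p.2) = 0.
    move=> pP; have /matrixP/(_ k0 (enum_rank_in pP p)) := mulmx_ker G.
    rewrite mxE [in RHS]mxE => E; rewrite -[RHS]E; apply: eq_bigr => i _.
    by congr (_ * _); rewrite mxE enum_rankK_in.
  apply/matrixP => k l; rewrite summxE [RHS]mxE.
  under eq_bigr => i _ do rewrite !mxE big_ord1 !mxE.
  have [kl|lk] := leqP k l; first by apply: (aP (k, l)); rewrite inE.
  under eq_bigr => i _ do rewrite (mulrC (d i 0 k)).
  by apply: (aP (l, k)); rewrite inE /= ltnW.
(* If the nonzero coefficient is negative, the opposite relation has a positive one. *)
have [ai0|ai0] := ltP 0 (a i0); first by exists a => //; exists i0.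
exists (fun i => - a i).
  by rewrite /outer_sum; under eq_bigr do rewrite scaleNr; rewrite sumrN -/(outer_sum a d) aG oppr0.
by exists i0; rewrite oppr_gt0 lt_neqAle a0.
Qed.

(* Caratheodory's theorem for cones, in the C(n+1,2)-dimensional space of
   symmetric matrices. *)
Lemma outer_sum_drop n (c : 'I_('C(n.+1, 2)).+1 -> R) (d : 'I_('C(n.+1, 2)).+1 -> 'rV[R]_n) :
  (forall i, 0 <= c i) ->
  exists i0, exists2 c' : 'I_('C(n.+1, 2)) -> R, (forall i, 0 <= c' i) &
    outer_sum c d = outer_sum c' (d \o lift i0).
Proof.
move=> c0; have [a aG [i1 ai1]] := outer_dependent d.
case: (@arg_minP _ _ _ i1 (fun i => 0 < a i) (fun i => c i / a i) ai1) => i0 /= ai0 imin.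
(* The largest multiple of the relation that can be subtracted with all coefficients staying
   nonnegative; the coefficient of [i0] then vanishes. *)
pose t := c i0 / a i0.
have c't i : 0 <= c i - t * a i.
  rewrite subr_ge0; have [ai|ai] := ltP 0 (a i).
    by rewrite -ler_pdivlMr //; exact: imin.
  by apply: le_trans (c0 i); rewrite mulr_ge0_le0 // divr_ge0 // ltW.
exists i0; exists (fun i => c (lift i0 i) - t * a (lift i0 i)) => //.
have -> : outer_sum c d = outer_sum (fun i => c i - t * a i) d.
  rewrite /outer_sum; under [RHS]eq_bigr do rewrite scalerBl -scalerA.
  by rewrite sumrB -scaler_sumr -/(outer_sum a d) aG scaler0 subr0.
rewrite /outer_sum (bigD1_ord i0) //= /t divfK ?subrr ?scale0r ?add0r //.
by rewrite gt_eqF.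
Qed.

(** The inner product tr (X^T Y), whose norm measures the distance to the cone. *)
Definition frob n (X Y : 'M[R]_n) : R := \sum_k \sum_l X k l * Y k l.

Lemma frobC n (X Y : 'M[R]_n) : frob X Y = frob Y X.
Proof. by apply: eq_bigr => k _; apply: eq_bigr => l _; rewrite mulrC. Qed.

Lemma frobDl n (X Y Z : 'M[R]_n) : frob (X + Y) Z = frob X Z + frob Y Z.
Proof.
rewrite /frob -big_split; apply: eq_bigr => k _; rewrite -big_split /=.
by apply: eq_bigr => l _; rewrite mxE mulrDl.
Qed.

Lemma frobZl n a (X Y : 'M[R]_n) : frob (a *: X) Y = a * frob X Y.
Proof.
rewrite /frob mulr_sumr; apply: eq_bigr => k _; rewrite mulr_sumr /=.
by apply: eq_bigr => l _; rewrite mxE mulrA.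
Qed.

Lemma frobDr n (X Y Z : 'M[R]_n) : frob X (Y + Z) = frob X Y + frob X Z.
Proof. by rewrite ![frob X _]frobC frobDl. Qed.

Lemma frobZr n a (X Y : 'M[R]_n) : frob X (a *: Y) = a * frob X Y.
Proof. by rewrite ![frob X _]frobC frobZl. Qed.

Lemma frobBB n (X Y : 'M[R]_n) s : frob (X - s *: Y) (X - s *: Y) =
  frob X X + (s * (-2 * frob X Y) + s ^+ 2 * frob Y Y).
Proof.
by rewrite -scaleNr !(frobDl, frobDr, frobZl, frobZr) (frobC Y X); ring.
Qed.

Lemma frob_ge0 n (X : 'M[R]_n) : 0 <= frob X X.
Proof. by apply: sumr_ge0 => k _; apply: sumr_ge0 => l _; rewrite -expr2 sqr_ge0. Qed.

Lemma frob_eq0 n (X : 'M[R]_n) : frob X X = 0 -> X = 0.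
Proof.
move=> X0; apply/matrixP => k l; rewrite [RHS]mxE; apply/eqP; rewrite -sqrf_eq0.
have r0 k' : 0 <= \sum_l X k' l * X k' l.
  by apply: sumr_ge0 => l' _; rewrite -expr2 sqr_ge0.
have := X0; move/eqP; rewrite psumr_eq0 // => /allP/(_ k (mem_index_enum _)).
rewrite psumr_eq0 => [/allP/(_ l (mem_index_enum _))|l' _]; first by rewrite -expr2.
by rewrite -expr2 sqr_ge0.
Qed.

Lemma frob1 n (X : 'M[R]_n) : frob X 1%:M = \tr X.
Proof.
apply: eq_bigr => k _; rewrite (bigD1 k) //= big1 => [|l lk].
  by rewrite mxE eqxx mulr1 addr0.
by rewrite mxE eq_sym (negPf lk) mulr0.
Qed.

Lemma frob_outer n (X : 'M[R]_n) (d : 'rV[R]_n) :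
  frob X (d^T *m d) = (d *m X *m d^T) 0 0.
Proof.
rewrite /frob exchange_big [RHS]mxE; apply: eq_bigr => l _ /=.
rewrite mxE mulr_suml; apply: eq_bigr => k _.
by rewrite !mxE big_ord1 !mxE; ring.
Qed.

(** The quadratic term is negligible for small [s]; this extracts first order conditions from
    one-sided perturbations. *)
Lemma quad_nonneg_linear (a b : R) :
  (forall s, 0 <= s <= 1 -> 0 <= s * a + s ^+ 2 * b) -> 0 <= a.
Proof.
move=> H; rewrite leNgt; apply/negP => a0.
(* For negative [a] this makes [s = - a / q] at most 1 and bounds [s * b] by [- a / 2]. *)
pose q := 2 * (`|b| - a); have b0 := normr_ge0 b.
have q0 : 0 < q by rewrite /q; lra.
pose s := - a / q.
have s0 : 0 < s by rewrite divr_gt0 // oppr_gt0.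
have s1 : s <= 1 by rewrite ler_pdivrMr // /q; lra.
have := H s; rewrite ltW //= => /(_ s1).
rewrite expr2 -mulrA -mulrDr pmulr_rge0 //.
have : s * b <= s * `|b| by rewrite ler_pM2l // ler_norm.
have : s * `|b| <= - a / 2.
  rewrite /s mulrAC ler_pdivrMr // -mulrA ler_pM2l ?oppr_gt0 // /q; lra.
lra.
Qed.

(* First order optimality of a nearest point to the identity in the cone
   generated by the matrices d^T d with d in D. *)
Lemma nearest_outer_sum n (D : 'rV[R]_n -> Prop) (c : 'I_('C(n.+1, 2)) -> R) d :
  (forall i, 0 <= c i) -> (forall i, D (d i)) ->
  (forall (c' : 'I_('C(n.+1, 2)) -> R) (d' : 'I_('C(n.+1, 2)) -> 'rV[R]_n),
    (forall i, 0 <= c' i) -> (forall i, D (d' i)) ->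
    frob (1%:M - outer_sum c d) (1%:M - outer_sum c d) <=
    frob (1%:M - outer_sum c' d') (1%:M - outer_sum c' d')) ->
  let H := 1%:M - outer_sum c d in
  frob H H <= \tr H /\ forall e, D e -> (e *m H *m e^T) 0 0 <= 0.
Proof.
move=> c0 Dd cmin H; set M := outer_sum c d in H cmin *.
split.
  (* Moving from [M] towards the apex of the cone, to [(1 - s) *: M], does not decrease the
     distance; this gives <H, M> >= 0, where tr H = <H, H> + <H, M>. *)
  suff : 0 <= -2 * frob H (- M).
    rewrite -(scaleN1r M) frobZr mulN1r mulrNN pmulr_rge0 // => HM.
    have -> : \tr H = frob H H + frob H M by rewrite -frobDr -frob1 /H subrK.
    by rewrite lerDl.
  apply: (@quad_nonneg_linear _ (frob (- M) (- M))) => s /andP[s0 s1].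
  have c'0 i : 0 <= (1 - s) * c i by rewrite mulr_ge0 // subr_ge0.
  have := cmin _ _ c'0 Dd.
  have -> : outer_sum (fun i => (1 - s) * c i) d = (1 - s) *: M.
    by rewrite /M /outer_sum scaler_sumr; apply: eq_bigr => i _; rewrite scalerA.
  have -> : 1%:M - (1 - s) *: M = H - s *: (- M).
    by rewrite scalerN opprK scalerBl scale1r opprB addrA addrAC.
  by rewrite frobBB lerDl.
(* Here the competitor is [M + s *: (e^T *m e)]. It has one summand too many, which Caratheodory's
   reduction removes. *)
move=> e De; suff : 0 <= -2 * frob H (e^T *m e).
  by rewrite -frob_outer mulNr oppr_ge0 pmulr_rle0.
apply: (@quad_nonneg_linear _ (frob (e^T *m e) (e^T *m e))) => s /andP[s0 _].
pose c' i := oapp c s (unlift ord0 i).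
pose d' i := oapp d e (unlift ord0 i).
have c'0 i : 0 <= c' i by rewrite /c'; case: unlift.
have [i0 [c'' c''0 E]] := outer_sum_drop d' c'0.
have D'' i : D ((d' \o lift i0) i) by rewrite /= /d'; case: unlift.
have := cmin _ _ c''0 D''; rewrite -E.
have -> : outer_sum c' d' = s *: (e^T *m e) + M.
  rewrite /outer_sum big_ord_recl {1}/c' {1 2}/d' unlift_none /=; congr (_ + _).
  by apply: eq_bigr => i _; rewrite /c' /d' liftK.
have -> : 1%:M - (s *: (e^T *m e) + M) = H - s *: (e^T *m e).
  by rewrite opprD addrA addrAC.
by rewrite frobBB lerDl.
Qed.

End cone_combinations.

Local Open Scope classical_set_scope.
Local Open Scope ring_scope.

(** * Lebesgue measure and linear maps *)

Section measure.
Context {R : realType}.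
Local Notation leb := (@lebesgue_measure R).

(** The pushforward under the translation agrees with Lebesgue measure on half-open intervals, which
    determine it. *)
Lemma lebesgue_measure_translate (B : set (measurableTypeR R)) (c : R) :
  measurable B -> leb [set x | B (x + c)] = leb B.
Proof.
move=> mB; apply/esym.
have mc : measurable_fun setT ((fun x => x + c) : measurableTypeR R -> measurableTypeR R).
  exact: measurable_funD.
apply: (@lebesgue_measure_unique R
  (pushforward leb ((fun x => x + c) : measurableTypeR R -> measurableTypeR R))) => //.
move=> _ [[p q] /= _ <-]; rewrite /pushforward.
rewrite (_ : _ @^-1` _ = `](p - c), (q - c)]%classic); last first.
  by apply/seteqP; split => x /=; rewrite !in_itv /= ltrBlDr lerBrDr.
rewrite !lebesgue_measure_itv /= !lte_fin ltrD2r; case: ifP => // _.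
by rewrite -!EFinB; congr EFin; ring.
Qed.

Lemma lebesgue_measure_scale (B : set (measurableTypeR R)) (a : R) : a != 0 ->
  measurable B -> (`|a|%:E * leb [set x | B (x * a)%R])%E = leb B.
Proof.
move=> a0 mB; apply/esym.
have ma : measurable_fun setT ((fun x => x * a) : measurableTypeR R -> measurableTypeR R).
  exact: measurable_funM.
apply: (@lebesgue_measure_unique R (mscale (NngNum (normr_ge0 a))
  (pushforward leb ((fun x => x * a) : measurableTypeR R -> measurableTypeR R)))) => //.
move=> _ [[p q] /= _ <-]; rewrite /mscale /= /pushforward.
have [ap|an] := ltP 0 a.
  rewrite (_ : _ @^-1` _ = `](p / a), (q / a)]%classic); last first.
    by apply/seteqP; split => x /=; rewrite !in_itv /= ltr_pdivrMr // ler_pdivlMr.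
  rewrite !lebesgue_measure_itv /= !lte_fin ltr_pM2r ?invr_gt0 //;
    case: ifP => _; last by rewrite mule0.
  by rewrite -!EFinB -EFinM gtr0_norm //; congr EFin; field.
have {}an : a < 0 by rewrite lt_neqAle a0.
(* A negative factor reverses the interval, so its other end is the closed one; its length does not
   change. *)
rewrite (_ : _ @^-1` _ = `[(q / a), (p / a)[%classic); last first.
  by apply/seteqP; split => x /=; rewrite !in_itv /= ltr_ndivlMr // ler_ndivrMr // andbC.
rewrite !lebesgue_measure_itv /= !lte_fin ltr_nM2r ?invr_lt0 //;
  case: ifP => _; last by rewrite mule0.
by rewrite -!EFinB -EFinM ltr0_norm //; congr EFin; field.
Qed.

(** The measure underlying [vol], kept in the extended reals so that slicing requires no
    finiteness. *)
Definition rvol n (S : set 'rV[R]_n) : \bar R :=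
  lebesgue_tuple n [set t | S (\row_i tnth t i)].

Definition rmeas n (S : set 'rV[R]_n) : Prop :=
  measurable ([set t | S (\row_i tnth t i)] : set (n.-tuple (measurableTypeR R))).

Lemma rmeas_affine n (A : 'M[R]_n) (b : 'rV[R]_n) (S : set 'rV[R]_n) :
  rmeas S -> rmeas [set v | S (v *m A + b)].
Proof.
move=> mS.
pose f (t : n.-tuple (measurableTypeR R)) : n.-tuple (measurableTypeR R) :=
  [tuple ((\row_j tnth t j) *m A + b) 0 i | i < n].
have mf : measurable_fun setT f.
  apply/measurable_fun_tnthP => i; rewrite /f.
  rewrite [X in measurable_fun _ X](_ : _ =
    (fun t : n.-tuple (measurableTypeR R) =>
       (\sum_j tnth t j * A j i) + b 0 i)); last first.
    apply/funext => t /=; rewrite tnth_mktuple !mxE; congr (_ + _).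
    by apply: eq_bigr => j _; rewrite mxE.
  apply: measurable_funD => //.
  apply: (@measurable_sum _ _ _ _ _ _
    (fun j (t : n.-tuple (measurableTypeR R)) => tnth t j * A j i)) => j.
  apply: measurable_funM => //. exact: (@measurable_tnth _ (measurableTypeR R)).
rewrite /rmeas [X in measurable X](_ : _ = f @^-1` [set t | S (\row_i tnth t i)]).
  by rewrite -[X in measurable X]setTI; exact: mf.
apply/funext => t /=; congr S; apply/rowP => i.
by rewrite [RHS]mxE tnth_mktuple.
Qed.

Lemma tuple_cons_row n x (t : n.-tuple (measurableTypeR R)) :
  \row_i tnth (tuple_cons (x, t)) i = row_mx x%:M (\row_i tnth t i) :> 'rV[R]_(1 + n).
Proof.
apply/rowP => i; rewrite !mxE; case: splitP => j /= ij.
  by rewrite !mxE (ord1 j) eqxx mulr1n (tnth_nth x) /= ij (ord1 j).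
by rewrite !mxE !(tnth_nth x) /= ij.
Qed.

Lemma measurable_cons_preimage n (S : set 'rV[R]_n.+1) : rmeas S ->
  measurable [set p : measurableTypeR R * n.-tuple (measurableTypeR R) |
    S (row_mx p.1%:M (\row_i tnth p.2 i) : 'rV_(1 + n))].
Proof.
move=> mS; rewrite [X in measurable X](_ : _ =
    @tuple_cons R n @^-1` [set t | S (\row_i tnth t i)]).
  by rewrite -[X in measurable X]setTI; exact: measurable_tuple_cons.
by apply/funext => -[x t] /=; rewrite tuple_cons_row.
Qed.

Lemma rvol_slice1 n (S : set 'rV[R]_n.+1) :
  rvol S = (\int[leb]_x rvol [set v : 'rV_n | S (row_mx x%:M v : 'rV_(1 + n))])%E.
Proof.
rewrite /rvol /= /lebesgue_step /pushforward /product_measure1.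
apply: eq_integral => x _ /=; congr (lebesgue_tuple _ _).
by apply/funext => t; rewrite /xsection /= in_setE /= tuple_cons_row.
Qed.

(** Integration in the other order: both iterated integrals agree on products of measurable sets, so
    they are the same product measure. *)
Lemma rvol_slice2 n (S : set 'rV[R]_n.+1) : rmeas S ->
  rvol S = (\int[lebesgue_tuple n]_t
    leb [set x | S (row_mx x%:M (\row_i tnth t i) : 'rV_(1 + n))])%E.
Proof.
move=> mS; rewrite /rvol /= /lebesgue_step /pushforward.
rewrite (@product_measure_unique _ _ _ _ _ _ _
  (product_measure2 (@lebesgue_measure R) (lebesgue_tuple n))).
- rewrite /product_measure2; apply: eq_integral => t _ /=; congr (leb _).
  by apply/funext => x; rewrite /ysection /= in_setE /= tuple_cons_row.
- by move=> A B mA mB; rewrite /= product_measure2E.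
- by rewrite -[X in measurable X]setTI; exact: measurable_tuple_cons.
Qed.

Lemma measurable_slice1 n (S : set 'rV[R]_n.+1) (x : R) : rmeas S ->
  rmeas [set v : 'rV_n | S (row_mx x%:M v : 'rV_(1 + n))].
Proof.
move=> mS; rewrite /rmeas.
have := measurable_xsection x (measurable_cons_preimage mS).
rewrite (_ : xsection _ x =
  [set t | S (row_mx x%:M (\row_i tnth t i) : 'rV_(1 + n))]) //.
by apply/funext => t; rewrite /xsection /= in_setE.
Qed.

Lemma measurable_slice2 n (S : set 'rV[R]_n.+1) (v : 'rV[R]_n) : rmeas S ->
  measurable ([set x | S (row_mx x%:M v : 'rV_(1 + n))] : set (measurableTypeR R)).
Proof.
move=> mS; pose t := [tuple v 0 i | i < n].
have := measurable_ysection t (measurable_cons_preimage mS).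
rewrite (_ : ysection _ t =
  [set x | S (row_mx x%:M v : 'rV_(1 + n))]) //.
apply/funext => x; rewrite /ysection /= in_setE /=; congr (S (row_mx _ _ : 'rV_(1 + n))).
by apply/rowP => i; rewrite mxE tnth_mktuple.
Qed.

Lemma measurable_rvol_slice n (S : set 'rV[R]_n.+1) : rmeas S ->
  measurable_fun setT (fun x : measurableTypeR R =>
    rvol [set v : 'rV_n | S (row_mx x%:M v : 'rV_(1 + n))]).
Proof.
move=> mS.
have := measurable_fun_xsection (lebesgue_tuple n) (measurable_cons_preimage mS).
congr measurable_fun; apply/funext => x /=; rewrite /rvol; congr (lebesgue_tuple _ _).
by apply/funext => t; rewrite /xsection /= in_setE.
Qed.

Lemma measurable_lebesgue_slice n (S : set 'rV[R]_n.+1) : rmeas S ->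
  measurable_fun setT (fun t : n.-tuple (measurableTypeR R) =>
    leb [set x | S (row_mx x%:M (\row_i tnth t i) : 'rV_(1 + n))]).
Proof.
move=> mS.
have := measurable_fun_ysection (@lebesgue_measure R) (measurable_cons_preimage mS).
congr measurable_fun; apply/funext => t /=; congr (leb _).
by apply/funext => x; rewrite /ysection /= in_setE.
Qed.

Lemma row_scalar_mxD n (x y : R) (v w : 'rV[R]_n) :
  (row_mx x%:M v : 'rV_(1 + n)) + (row_mx y%:M w : 'rV_(1 + n)) =
  (row_mx (x + y)%:M (v + w) : 'rV_(1 + n)) :> 'rV_n.+1.
Proof. by rewrite raddfD; exact: (@add_row_mx _ 1 1 n). Qed.

Lemma rmeas_translate n (b : 'rV[R]_n) (S : set 'rV[R]_n) :
  rmeas S -> rmeas [set v | S (v + b)].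
Proof.
by move=> /(rmeas_affine 1%:M b); under eq_fun do rewrite mulmx1.
Qed.

Lemma rmeas_linear n (A : 'M[R]_n) (S : set 'rV[R]_n) :
  rmeas S -> rmeas [set v | S (v *m A)].
Proof.
by move=> /(rmeas_affine A 0); under eq_fun do rewrite addr0.
Qed.

(** The last coordinates are translated slice by slice using the induction hypothesis, the first one
    along each line parallel to the first axis. *)
Lemma rvol_translate n (b : 'rV[R]_n) (S : set 'rV[R]_n) :
  rmeas S -> rvol [set v | S (v + b)] = rvol S.
Proof.
elim: n b S => [|n IH] b S mS; first by congr rvol; apply/funext => v; congr S; apply/rowP => -[].
pose b0 := b 0 0; pose b' : 'rV_n := \row_i b 0 (lift 0 i).
have bE : b = row_mx b0%:M b' :> 'rV_(1 + n).
  apply/rowP => i; rewrite !mxE; case: splitP => j /= ij.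
    by rewrite (ord1 j) mxE eqxx mulr1n /b0; congr (b _ _); apply/val_inj; rewrite /= ij (ord1 j).
  by rewrite mxE; congr (b _ _); apply/val_inj; rewrite /= ij.
pose S' := [set v : 'rV_n.+1 | S (v + row_mx b0%:M 0 : 'rV_(1 + n))].
have mS' : rmeas S' by exact: rmeas_translate.
transitivity (rvol S').
  rewrite !rvol_slice1; apply: eq_integral => x _.
  rewrite -[RHS](IH b'); last exact: measurable_slice1.
  congr rvol; apply/funext => v /=; rewrite /S' /=; congr S.
  by rewrite bE !row_scalar_mxD !addr0.
rewrite !rvol_slice2 //; apply: eq_integral => t _.
rewrite -[RHS](lebesgue_measure_translate b0); last exact: measurable_slice2.
congr (leb _); apply/funext => x /=; rewrite /S' /=; congr S.
by rewrite row_scalar_mxD addr0.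
Qed.

(** On each line parallel to the first axis this shear is a translation. *)
Lemma rvol_lower_shear n (c : 'cV[R]_n) (S : set 'rV[R]_n.+1) : rmeas S ->
  rvol [set v | S (v *m (block_mx 1%:M 0 c 1%:M : 'M[R]_(1 + n)))] = rvol S.
Proof.
move=> mS; rewrite !rvol_slice2 //; last exact: rmeas_linear.
apply: eq_integral => t _; set v := \row_i _.
rewrite -[RHS](lebesgue_measure_translate ((v *m c) 0 0)); last exact: measurable_slice2.
congr (leb _); apply/funext => x /=; congr S.
rewrite mul_row_block !mulmx1 mulmx0 add0r.
by rewrite raddfD /= -mx11_scalar.
Qed.

(** On each hyperplane with fixed first coordinate this shear is a translation. *)
Lemma rvol_upper_shear n (r : 'rV[R]_n) (S : set 'rV[R]_n.+1) : rmeas S ->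
  rvol [set v | S (v *m (block_mx 1%:M r 0 1%:M : 'M[R]_(1 + n)))] = rvol S.
Proof.
move=> mS; rewrite !rvol_slice1; apply: eq_integral => x _.
rewrite -[RHS](rvol_translate (x%:M *m r)); last exact: measurable_slice1.
congr rvol; apply/funext => v /=; congr S.
by rewrite mul_row_block !mulmx1 mulmx0 addr0 addrC.
Qed.

(** Stated with preimages, which inherit measurability from [S], so that products of matrices are
    handled by composition. *)
Definition scales_rvol n (A : 'M[R]_n) := forall S, rmeas S ->
  (`|\det A|%:E * rvol [set v | S (v *m A)%R])%E = rvol S.

Lemma scales_rvol_mul n (A B : 'M[R]_n) :
  scales_rvol A -> scales_rvol B -> scales_rvol (A *m B).
Proof.
move=> sA sB S mS; rewrite det_mulmx normrM mulrC EFinM -muleA.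
rewrite (_ : [set v | _] = [set v | [set w | S (w *m B)] (v *m A)]).
  by rewrite sA ?sB //; exact: rmeas_linear.
by apply/funext => v /=; rewrite mulmxA.
Qed.

Lemma scales_rvol_shear n (A : 'M[R]_n) : \det A = 1 ->
  (forall S, rmeas S -> rvol [set v | S (v *m A)] = rvol S) -> scales_rvol A.
Proof. by move=> d1 sA S mS; rewrite d1 normr1 mul1e sA. Qed.

Lemma scales_rvol_block n (a : R) (A : 'M[R]_n) : a != 0 -> scales_rvol A ->
  scales_rvol (block_mx a%:M 0 0 A : 'M[R]_(1 + n)).
Proof.
move=> a0 sA S mS.
pose S' := [set v : 'rV_(1 + n) | S (v *m (block_mx 1%:M 0 0 A : 'M[R]_(1 + n)))].
have mS' : rmeas S' by exact: rmeas_linear.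
have E1 : (`|\det A|%:E * rvol S' = rvol S)%E.
  rewrite !rvol_slice1 -ge0_integralZl //; last first.
    exact: measurable_rvol_slice.
  apply: eq_integral => x _; rewrite -[RHS]sA; last exact: measurable_slice1.
  congr (_ * rvol _)%E; apply/funext => v /=; rewrite /S' /=; congr S.
  by rewrite mul_row_block !mulmx0 !mulmx1 addr0 add0r.
rewrite -E1 det_ublock det_scalar1 normrM mulrC EFinM -muleA; congr (_ * _)%E.
rewrite !rvol_slice2 //; last exact: rmeas_linear.
rewrite -ge0_integralZl //; last first.
  apply: (@measurable_lebesgue_slice n
    [set v | S (v *m (block_mx a%:M 0 0 A : 'M[R]_(1 + n)))]).
  exact: rmeas_linear.
apply: eq_integral => t _; set v := \row_i _.
rewrite -[RHS](lebesgue_measure_scale a0); last exact: measurable_slice2.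
congr (_ * leb _)%E; apply/funext => x /=; rewrite /S' /=; congr S.
by rewrite !mul_row_block !mulmx0 mulmx1 !addr0 !add0r -scalar_mxM.
Qed.

(** Block elimination: a matrix with nonzero corner entry is a lower shear times a block diagonal
    matrix times an upper shear. A zero corner is first repaired by a row operation. *)
Lemma rvol_linear n (A : 'M[R]_n) : A \in unitmx -> scales_rvol A.
Proof.
elim: n A => [|n IH] A uA.
  move=> S mS; rewrite det_mx00 normr1 mul1e; congr rvol.
  by apply/funext => v; congr S; apply/rowP => -[].
have main (B : 'M[R]_(1 + n)) : B \in unitmx -> B 0 0 != 0 -> scales_rvol B.
  move=> uB a0; pose a := B 0 0; pose r := ursubmx B; pose c := dlsubmx B.
  (* The Schur complement of the corner entry. *)
  pose D := drsubmx B - a^-1 *: (c *m r).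
  have BE : B = block_mx 1%:M 0 (a^-1 *: c) 1%:M *m block_mx a%:M 0 0 D *m
      block_mx 1%:M (a^-1 *: r) 0 1%:M.
    rewrite !mulmx_block !(mul0mx, mulmx0, mul1mx, mulmx1, addr0, add0r).
    rewrite -[LHS]submxK; congr block_mx.
    - by rewrite [LHS]mx11_scalar; congr (_%:M); rewrite !mxE; congr (B _ _); apply/val_inj.
    - by rewrite mul_scalar_mx scalerA divff // scale1r.
    - by rewrite mul_mx_scalar scalerA divff // scale1r.
    - by rewrite mul_mx_scalar scalerA divff // scale1r -scalemxAr /D addrC subrK.
  have uD : D \in unitmx.
    move: uB; rewrite BE !unitmx_mul => /andP[/andP[_]].
    by rewrite !unitmxE det_ublock det_scalar1 unitrM => /andP[].
  rewrite BE; apply: scales_rvol_mul; first apply: scales_rvol_mul.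
  - apply: scales_rvol_shear; last exact: rvol_lower_shear.
    by rewrite det_lblock !det1 mul1r.
  - by apply: scales_rvol_block => //; exact: IH.
  - apply: scales_rvol_shear; last exact: rvol_upper_shear.
    by rewrite det_ublock !det1 mul1r.
have [a0|] := eqVneq (A 0 0) 0; last exact: main.
have [i ai0] : exists i : 'I_n, A (lift 0 i) 0 != 0.
  apply/existsP; apply: contraLR uA; rewrite negb_exists => /forallP A0.
  rewrite unitmxE (expand_det_col _ 0) big1 ?unitr0 // => i _.
  case: (unliftP 0 i) => [j ->|->]; last by rewrite a0 mul0r.
  by have := A0 j; rewrite negbK => /eqP ->; rewrite mul0r.
(* [U 1] adds the row with nonzero first entry to the top row, and [U (-1)] undoes it. *)
pose U (s : R) : 'M[R]_(1 + n) := block_mx 1%:M (s *: delta_mx 0 i) 0 1%:M.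
have detU s : \det (U s) = 1 by rewrite det_ublock !det1 mul1r.
have AE : A = U (-1) *m (U 1 *m A).
  rewrite mulmxA mulmx_block !(mul0mx, mulmx0, mul1mx, mulmx1, addr0, add0r).
  by rewrite -scalerDl subrr scale0r -scalar_mx_block mul1mx.
rewrite AE; apply: scales_rvol_mul.
  by apply: scales_rvol_shear => //; exact: rvol_upper_shear.
apply: main; first by rewrite unitmx_mul uA andbT unitmxE detU unitr1.
have U1 (j : 'I_n) : U 1 0 (lift ord0 j) = (j == i)%:R.
  have -> : lift ord0 j = rshift 1 j by apply/val_inj.
  have -> : (0 : 'I_n.+1) = lshift n (0 : 'I_1) by apply/val_inj.
  by rewrite block_mxEur !mxE /= mul1r.
rewrite mxE big_ord_recl a0 mulr0 add0r (bigD1 i) //= big1 ?addr0 => [|j ji].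
  by rewrite U1 eqxx mul1r.
by rewrite U1 (negPf ji) mul0r.
Qed.

End measure.

(** * Volumes of compact sets, cones and simplices *)

Section compact_sets.
Context {R : realType}.
Local Notation leb := (@lebesgue_measure R).

Lemma continuous_mx (X : topologicalType) m n (f : X -> 'M[R]_(m, n)) :
  (forall i j, continuous (fun x => f x i j)) -> continuous f.
Proof.
move=> cf x; apply/cvg_ballP => e e0.
have H : \forall y \near x, forall i j, ball (f x i j) e (f y i j).
  apply: filter_forall => i; apply: filter_forall => j.
  exact: (cvg_ball (cf i j x)).
by apply: filterS H => y H; split.
Qed.

Lemma rmeas_box n (A : 'I_n -> set (measurableTypeR R)) :
  (forall i, measurable (A i)) -> rmeas [set v : 'rV[R]_n | forall i, A i (v 0 i)].
Proof.
move=> mA; rewrite /rmeas [X in measurable X](_ : _ =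
  \big[setI/setT]_(i < n) ((fun t : n.-tuple (measurableTypeR R) => tnth t i) @^-1` A i)).
  apply: bigsetI_measurable => i _; rewrite -[X in measurable X]setTI.
  exact: measurable_tnth.
apply/seteqP; split => t /=.
  by move=> At; rewrite -bigcap_seq => i _; have := At i; rewrite mxE.
by rewrite -bigcap_seq => At i; rewrite mxE; apply: At => /=; rewrite mem_index_enum.
Qed.

Lemma rvol_box n (A : 'I_n -> set (measurableTypeR R)) :
  (forall i, measurable (A i)) ->
  rvol [set v : 'rV[R]_n | forall i, A i (v 0 i)] = (\prod_(i < n) leb (A i))%E.
Proof.
move=> mA; rewrite -lebesgue_tuple_box // /rvol; congr (lebesgue_tuple _ _).
by apply/funext => t; apply/propext; split => /= H i; have := H i; rewrite mxE.
Qed.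

Lemma rmeas_ball n (x : 'rV[R]_n) e : rmeas (ball x e).
Proof.
have [e0|e0] := ltP 0 e; last first.
  rewrite (_ : ball x e = set0); first exact: (@measurable0 _ (n.-tuple (measurableTypeR R))).
  by rewrite -subset0 => y [/lt_le_trans/(_ e0)]; rewrite ltxx.
rewrite (_ : ball x e = [set v | forall i, ball (x 0 i) e (v 0 i)]).
  apply: (@rmeas_box n (fun i => ball (x 0 i) e)) => i; exact: measurable_ball.
apply/seteqP; split => [y [_ H] i|y H]; first exact: H.
by split => // i j; rewrite (ord1 i); exact: H.
Qed.

(* A compact set is the intersection over k of finite unions of balls of radius
   1/(k+1), and the balls of the sup norm are boxes. *)
Lemma compact_rmeas n (K : set 'rV[R]_n) : compact K -> rmeas K.
Proof.
move=> cK.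
have cover k : exists D : {fset 'rV[R]_n}, [set` D] `<=` K /\
    K `<=` \bigcup_(x in [set` D]) ball x k.+1%:R^-1.
  have := cK; rewrite compact_cover => /(_ _ K (fun x => (ball x k.+1%:R^-1)^°)).
  case.
  - by move=> x _; exact: open_interior.
  - by move=> x Kx; exists x => //; apply: nbhsx_ballx; rewrite invr_gt0.
  move=> D DK KD; exists D; split; first by move=> x Dx; apply: set_mem; exact: DK.
  by move=> x /KD[y Dy]/interior_subset yx; exists y.
have [D HD] := choice cover.
rewrite (_ : K = \bigcap_k \bigcup_(x in [set` D k]) ball x k.+1%:R^-1).
  rewrite /rmeas [X in measurable X](_ : _ = \bigcap_k \bigcup_(x in [set` D k])
    [set t : n.-tuple (measurableTypeR R) | ball x k.+1%:R^-1 (\row_i tnth t i)]) //.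
  apply: bigcap_measurable => // k _; apply: fin_bigcup_measurable => // x _.
  exact: rmeas_ball.
apply/seteqP; split => [x Kx k _|x Dx]; first by apply: (HD k).2.
(* A point of the intersection has points of [K] at arbitrarily small distance, so it lies in the
   closure of [K]. *)
have /closure_id -> : closed K by apply: compact_closed => //; exact: norm_hausdorff.
move=> B /nbhs_ballP[e /= e0 eB].
have [k ke] : exists k : nat, k.+1%:R^-1 < e.
  have [k _ ke] := near_infty_natSinv_lt (PosNum e0).
  by exists k; exact: (ke k (leqnn k)).
have [y Dy yx] := Dx k Logic.I; exists y; split; first exact: (HD k).1.
by apply: eB; apply: ball_sym; apply: le_ball yx; exact: ltW.
Qed.

Lemma le_rvol n (S S' : set 'rV[R]_n) : rmeas S -> rmeas S' -> S `<=` S' ->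
  (rvol S <= rvol S')%E.
Proof. by move=> mS mS' SS'; apply: le_measure; [exact: mem_set..|move=> t; exact: SS']. Qed.

Lemma rvol_ge0 n (S : set 'rV[R]_n) : (0 <= rvol S)%E.
Proof. exact: measure_ge0. Qed.

Lemma norm_coord_le n (v : 'rV[R]_n) i : `|v 0 i| <= `|v|.
Proof.
rewrite [leRHS]/Num.Def.normr /= mx_normrE.
by apply/bigmax_geP; right => /=; exists (0, i).
Qed.

Lemma compact_rvol_fin n (K : set 'rV[R]_n) : compact K -> rvol K \is a fin_num.
Proof.
move=> cK; have [M [_ KM]] := compact_bounded cK.
(* Boundedness is available only for bounds strictly above [M], hence [M + 1]. *)
pose A (i : 'I_n) : set (measurableTypeR R) := `[- (M + 1), M + 1]%classic.
have mA i : measurable (A i) by exact: measurable_itv.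
rewrite ge0_fin_numE ?rvol_ge0 //.
apply: (@le_lt_trans _ _ (\prod_(i < n) leb (A i))%E).
  rewrite -rvol_box //; apply: le_rvol; [exact: compact_rmeas|exact: rmeas_box|].
  move=> v Kv i; rewrite /A /= in_itv /= -ler_norml.
  by apply: le_trans (norm_coord_le v i) _; apply: KM => //; rewrite ltrDl.
rewrite ltey_eq prode_fin_num // => i _.
by rewrite /A lebesgue_measure_itv /=; case: ifP => // _; rewrite -EFinB.
Qed.

(** The cone with base {0} x Q and apex (1, x0); its slice at height [t] is a copy of [Q] shrunk by
    the factor [1 - t]. *)
Definition cone_over n (x0 : 'rV[R]_n) (Q : set 'rV[R]_n) : set 'rV[R]_n.+1 :=
  [set w | exists t q, [/\ 0 <= t <= 1, Q q &
     w = (row_mx t%:M (t *: x0 + (1 - t) *: q) : 'rV_(1 + n))]].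

Lemma compact_cone n (x0 : 'rV[R]_n) Q : compact Q -> compact (cone_over x0 Q).
Proof.
move=> cQ; pose f (p : R * 'rV[R]_n) : 'rV[R]_n.+1 :=
  (row_mx p.1%:M (p.1 *: x0 + (1 - p.1) *: p.2) : 'rV_(1 + n)).
have -> : cone_over x0 Q = f @` (`[0, 1] `*` Q).
  apply/seteqP; split => [w [t [q [t01 Qq ->]]]|_ [[t q] [/= t01 Qq] <-]].
    by exists (t, q) => //; split => //=; rewrite in_itv.
  by exists t, q; split => //; move: t01; rewrite in_itv.
apply: continuous_compact; last by apply: compact_setX => //; exact: segment_compact.
apply: continuous_subspaceT; apply: continuous_mx => i j.
rewrite /f; case: (splitP (j : 'I_(1 + n))) => k jk.
  have -> : j = lshift n k by apply/val_inj.
  under eq_fun do rewrite (@row_mxEl _ 1 1 n) mxE (ord1 i) (ord1 k) eqxx mulr1n.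
  by move=> p; exact: cvg_fst.
have -> : j = rshift 1 k by apply/val_inj.
under eq_fun do rewrite (@row_mxEr _ 1 1 n) !mxE.
move=> p; apply: cvgD.
  by apply: cvgM; [exact: cvg_fst|exact: cvg_cst].
apply: cvgM; first by apply: cvgB; [exact: cvg_cst|exact: cvg_fst].
apply: (cvg_comp _ (fun v : 'rV[R]_n => v i k)); first exact: cvg_snd.
exact: coord_continuous.
Qed.

Lemma rvol_affine_image n (x0 : 'rV[R]_n) (t : R) (Q : set 'rV[R]_n) : compact Q -> 0 <= t < 1 ->
  rvol [set v | exists2 q, Q q & v = t *: x0 + (1 - t) *: q] =
  (((1 - t) ^+ n)%:E * rvol Q)%E.
Proof.
move=> cQ /andP[t0 t1]; have s0 : 0 < 1 - t by rewrite subr_gt0.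
pose S := [set v | Q (v *m ((1 - t)^-1)%:M)].
have mS : rmeas S by apply: rmeas_linear; exact: compact_rmeas.
have -> : [set v | exists2 q, Q q & v = t *: x0 + (1 - t) *: q] =
    [set v | S (v + - (t *: x0))].
  apply/seteqP; split => [_ [q Qq ->]|v /=].
    by rewrite /S /= addrC addKr mul_mx_scalar scalerA mulVf ?gt_eqF // scale1r.
  rewrite /S /= mul_mx_scalar => Qv; exists ((1 - t)^-1 *: (v - t *: x0)) => //.
  by rewrite scalerA divff ?gt_eqF // scale1r addrC subrK.
rewrite rvol_translate //.
have uS : (((1 - t)^-1)%:M : 'M[R]_n) \in unitmx.
  by rewrite unitmxE det_scalar unitfE expf_neq0 // invr_eq0 gt_eqF.
rewrite -(rvol_linear uS (compact_rmeas cQ)) det_scalar muleA -EFinM.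
rewrite exprVn ger0_norm ?invr_ge0 ?exprn_ge0 ?ltW // divff ?mul1e //.
by rewrite expf_neq0 // gt_eqF.
Qed.

Lemma integral_onemX n :
  (\int[leb]_(x in `[0%R, 1%R]) ((1 - x) ^+ n)%:E = (n.+1%:R^-1)%:E)%E.
Proof.
rewrite -(@Rintegral_onemXn R) /Rintegral fineK //.
apply: integrable_fin_num => //.
have := @integrable_XMonemX R 0 n; congr (integrable _ _).
by apply/funext => x /=; rewrite XMonemX0n.
Qed.

(** The slice at height t has volume (1 - t)^n vol Q, and the integral of (1 - t)^n over [0, 1] is 1
    / (n + 1). *)
Lemma rvol_cone n (x0 : 'rV[R]_n) Q : compact Q ->
  (n.+1%:R%:E * rvol (cone_over x0 Q) = rvol Q)%E.
Proof.
move=> cQ; rewrite rvol_slice1.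
pose g (t : R) := rvol [set v : 'rV_n | cone_over x0 Q (row_mx t%:M v : 'rV_(1 + n))].
have gE (t : R) : 0 <= t <= 1 ->
    g t = rvol [set v | exists2 q, Q q & v = t *: x0 + (1 - t) *: q].
  move=> t01; congr rvol; apply/seteqP; split => v /=.
    move=> [t' [q [t'01 Qq]]] /(@eq_row_mx _ 1 1 n) [tt' ->].
    have := tt'; rewrite -matrixP => /(_ 0 0); rewrite !mxE !eqxx !mulr1n => ->.
    by exists q.
  by move=> [q Qq ->]; exists t, q.
have g0 (t : R) : ~~ (0 <= t <= 1) -> g t = 0%E.
  move=> t01; rewrite /g (_ : [set v | _] = set0).
    exact: (@measure0 _ _ _ (lebesgue_tuple n)).
  rewrite -subset0 => v [t' [q [t'01 Qq]]] /(@eq_row_mx _ 1 1 n) [tt' _].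
  have := tt'; rewrite -matrixP => /(_ 0 0); rewrite !mxE !eqxx !mulr1n => E.
  by rewrite E t'01 in t01.
have mg : measurable_fun setT (g : measurableTypeR R -> \bar R).
  by apply: measurable_rvol_slice; apply: compact_rmeas; exact: compact_cone.
have -> : (\int[leb]_x g x = \int[leb]_(x in `[0%R, 1%R]) g x)%E.
  rewrite [RHS]integral_mkcond; apply: eq_integral => x _.
  rewrite /patch; case: ifPn => // /negP x01; apply: g0; apply/negP => H.
  by apply: x01; rewrite inE /= in_itv.
(* The height 1 is discarded as a null set, since the homothety is not invertible there. *)
rewrite -integral_itv_bndo_bndc; last exact: measurable_funTS.
have -> : (\int[leb]_(x in `[0%R, 1%R[) g x =
    \int[leb]_(x in `[0%R, 1%R[) (((1 - x) ^+ n)%:E * rvol Q))%E.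
  apply: eq_integral => x; rewrite inE /= in_itv /= => /andP[x0' x1].
  by rewrite gE ?x0' ?ltW //= rvol_affine_image // x0' x1.
rewrite ge0_integralZr //; last 2 first.
- apply/measurable_EFinP; apply: measurable_funTS; apply: measurable_funX.
  exact: measurable_funB.
- move=> x; rewrite /= in_itv /= => /andP[_ x1].
  by rewrite lee_fin exprn_ge0 // subr_ge0 ltW.
rewrite integral_itv_bndo_bndc; last first.
  apply/measurable_EFinP; apply: measurable_funTS; apply: measurable_funX.
  exact: measurable_funB.
rewrite integral_onemX muleA -EFinM divff ?mul1e //.
Qed.

Lemma convex_comb n (K : set 'rV[R]_n) x y (t : R) :
  convex_set K -> 0 <= t <= 1 -> K x -> K y -> K (t *: x + (1 - t) *: y).
Proof.
move=> cK /andP[t0 t1] Kx Ky.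
have t01 : Itv.spec (@Itv.num_sem R) (Itv.Real `[0%Z, 1%Z]) t.
  by rewrite /Itv.spec /Itv.num_sem /= ger0_real //= in_itv /= t0.
by have := cK x y (Itv.mk t01) (mem_set Kx) (mem_set Ky); rewrite inE.
Qed.

Lemma le_rvol_slices n (C S : set 'rV[R]_n.+1) : rmeas C -> rmeas S ->
  (forall v : 'rV[R]_n, (leb [set x | C (row_mx x%:M v : 'rV_(1 + n))] <=
    leb [set x | S (row_mx x%:M v : 'rV_(1 + n))])%E) ->
  (rvol C <= rvol S)%E.
Proof.
move=> mC mS CS; rewrite !rvol_slice2 //; apply: ge0_le_integral => //.
- exact: measurable_lebesgue_slice.
- exact: measurable_lebesgue_slice.
Qed.

(* Let Q be the projection of K along the first axis and x0 that of [a 0]. Over the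
   point t x0 + (1 - t) q with q in Q, K contains a segment of length t, so the
   fibres of K are at least as long as those of the cone with apex x0 and base Q. *)
Lemma rvol_ge_segments n (K : set 'rV[R]_n) (a : 'I_n -> 'rV[R]_n) :
  compact K -> convex_set K -> K !=set0 ->
  (forall i, K (a i) /\ K (a i + delta_mx 0 i)) ->
  (1 <= n`!%:R%:E * rvol K)%E.
Proof.
elim: n K a => [|n IH] K a cK vK [w Kw] Ka.
  have -> : K = setT by apply/seteqP; split => // v _; rewrite (_ : v = w) //; apply/rowP => -[].
  by rewrite fact0 mul1e /rvol /= diracT.
pose p (v : 'rV[R]_n.+1) : 'rV[R]_n := rsubmx (v : 'rV_(1 + n)).
have cp : continuous p.
  apply: continuous_mx => i j; rewrite /p; under eq_fun do rewrite mxE.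
  exact: coord_continuous.
pose Q := p @` K.
have cQ : compact Q by apply: continuous_compact => //; exact: continuous_subspaceT.
have vQ : convex_set Q.
  move=> _ _ l /set_mem[x Kx <-] /set_mem[y Ky <-]; apply/mem_set.
  exists (l%:num *: x + (1 - l%:num) *: y).
    by apply: convex_comb => //; apply/andP; split; [exact: ge0|exact: le1].
  by apply/rowP => i; rewrite !mxE.
pose x0 := p (a 0).
have QE : (1 <= n`!%:R%:E * rvol Q)%E.
  apply: (IH _ (fun i => p (a (lift 0 i)))) => //; first by exists (p w), w.
  move=> i; split; first by exists (a (lift 0 i)) => //; exact: (Ka _).1.
  exists (a (lift 0 i) + delta_mx 0 (lift 0 i)); first exact: (Ka _).2.
  by apply/rowP => j; rewrite !mxE !eqxx /=; congr (_ + _).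
rewrite factS natrM mulrC EFinM -muleA; apply: (le_trans QE).
rewrite lee_pmul2l ?lte_fin ?ltr0n ?fact_gt0 // -(rvol_cone x0 cQ).
rewrite lee_pmul2l ?lte_fin ?ltr0n //.
have mK := compact_rmeas cK.
apply: le_rvol_slices => //; first by apply: compact_rmeas; exact: compact_cone.
move=> v; set C := [set x | cone_over _ _ _]; set S := [set x | K _].
have mC : measurable (C : set (measurableTypeR R)).
  by apply: measurable_slice2; apply: compact_rmeas; exact: compact_cone.
have mS : measurable (S : set (measurableTypeR R)) by exact: measurable_slice2.
have CS (t : R) : C t -> 0 <= t <= 1 /\ (t%:E <= leb S)%E.
  move=> [t' [q [t'01 [k Kk <-]]]] /(@eq_row_mx _ 1 1 n) [tt' vE].
  have := tt'; rewrite -matrixP => /(_ 0 0); rewrite !mxE !eqxx !mulr1n => ->.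
  split=> //; have /andP[t0 t1] := t'01.
  (* The fibre contains the segment from [s] to [s + t'], obtained by combining the unit segment at
     [a 0] with the point [k] above [q]. *)
  pose s := (t' *: a 0 + (1 - t') *: k) 0 0.
  have seg r : 0 <= r <= t' -> K (row_mx (s + r)%:M (t' *: x0 + (1 - t') *: p k) : 'rV_(1 + n)).
    move=> /andP[r0 rt]; pose d := r / t'.
    have d01 : 0 <= d <= 1.
      rewrite /d divr_ge0 //=; have [->|t'0] := eqVneq t' 0; first by rewrite invr0 mulr0.
      by rewrite ler_pdivrMr ?mul1r // lt_neqAle eq_sym t'0.
    have -> : r = t' * d.
      have [t'0|t'0] := eqVneq t' 0; last by rewrite mulrC divfK.
      by rewrite t'0 mul0r; apply/eqP; rewrite eq_le r0 -t'0 rt.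
    have -> : (row_mx (s + t' * d)%:M (t' *: x0 + (1 - t') *: p k) : 'rV_(1 + n)) =
       t' *: (d *: (a 0 + delta_mx 0 0) + (1 - d) *: a 0) + (1 - t') *: k.
      apply/rowP => i; rewrite /x0 /p /s; case: (splitP (i : 'I_(1 + n))) => l il.
        have -> : i = lshift n l by apply/val_inj.
        rewrite (@row_mxEl _ 1 1 n) (ord1 l) !mxE /= mulr1n.
        have -> : lshift n (0 : 'I_1) = 0 by apply/val_inj.
        by ring.
      have -> : i = rshift 1 l by apply/val_inj.
      by rewrite (@row_mxEr _ 1 1 n) !mxE /=; ring.
    have [? ?] := Ka 0; by apply: convex_comb => //; apply: convex_comb.
  have -> : t' = s + t' - s by ring.
  rewrite (_ : _%:E = leb `[s, s + t']%classic).
    apply: le_measure; rewrite ?inE //.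
    move=> r /=; rewrite in_itv /= => /andP[sr rs]; rewrite /S /=.
    by have := seg (r - s); rewrite (addrC s) subrK -vE; apply; rewrite subr_ge0 sr lerBlDl.
  rewrite lebesgue_measure_itv /= lte_fin ltrDl; case: ltP => [_|]; first by rewrite -EFinB.
  by move=> t'0; rewrite addrC addKr (_ : t' = 0) //; apply/eqP; rewrite eq_le t0 t'0.
have [fS|] := boolP (leb S \is a fin_num); last first.
  by rewrite ge0_fin_numE // -leNgt leye_eq => /eqP ->; rewrite leey.
(* Each height in [C] lies between 0 and the length of [S], so [C] fits in an interval of that
   length. *)
apply: (@le_trans _ _ (leb `[0%R, fine (leb S)]%classic)).
  apply: le_measure; rewrite ?inE //.
  move=> t /CS[/andP[t0 _] tS]; rewrite /= in_itv /= t0 /=.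
  by rewrite -lee_fin fineK.
rewrite lebesgue_measure_itv /= lte_fin; case: ifP => _ //.
by rewrite sube0 fineK.
Qed.

End compact_sets.

Section simplices.
Context {R : realType}.

Lemma continuous_sumr (X : topologicalType) (I : Type) (r : seq I) (F : I -> X -> R) :
  (forall i, continuous (F i)) -> continuous (fun x => \sum_(i <- r) F i x).
Proof.
move=> cF; apply: continuous_big => // p.
by apply: cvgD; [exact: cvg_fst|exact: cvg_snd].
Qed.

Lemma continuous_mulmx m n p (A : 'M[R]_(n, p)) :
  continuous (fun x : 'M[R]_(m, n) => x *m A).
Proof.
apply: continuous_mx => i j; under eq_fun do rewrite mxE.
apply: continuous_sumr => k x; apply: continuousM; last exact: cst_continuous.
exact: coord_continuous.
Qed.

Lemma linear_imageE n (A : 'M[R]_n) (K : set 'rV[R]_n) : A \in unitmx ->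
  linear_image A K = [set v | K (v *m invmx A)].
Proof.
move=> uA; apply/seteqP; split => [_ [x Kx <-]|v Kv]; first by rewrite /= mulmxK.
by exists (v *m invmx A) => //; rewrite mulmxKV.
Qed.

Lemma compact_linear_image n (A : 'M[R]_n) K : compact K -> compact (linear_image A K).
Proof.
move=> cK; apply: continuous_compact => //; apply: continuous_subspaceT.
exact: continuous_mulmx.
Qed.

Lemma convex_linear_image n (A : 'M[R]_n) K : convex_set K -> convex_set (linear_image A K).
Proof.
move=> cK _ _ l /set_mem[x Kx <-] /set_mem[y Ky <-]; apply/mem_set.
exists (l%:num *: x + (1 - l%:num) *: y).
  by apply: convex_comb => //; apply/andP; split; [exact: ge0|exact: le1].
by rewrite mulmxDl -!scalemxAl.
Qed.

Lemma rvol_linear_image n (A : 'M[R]_n) K : A \in unitmx -> compact K ->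
  rvol (linear_image A K) = (`|\det A|%:E * rvol K)%E.
Proof.
move=> uA cK; have uA' : invmx A \in unitmx by rewrite unitmx_inv.
rewrite -(rvol_linear uA' (compact_rmeas cK)) -linear_imageE // muleA -EFinM -normrM.
by rewrite -det_mulmx mulmxV // det1 normr1 mul1e.
Qed.

(** The inverse of the matrix of the [u i] maps these directions to the coordinate vectors; for
    dependent directions the left-hand side is 0. *)
Lemma rvol_ge_directions n (K : set 'rV[R]_n) (a u : 'I_n -> 'rV[R]_n) :
  compact K -> convex_set K -> K !=set0 ->
  (forall i, K (a i) /\ K (a i + u i)) ->
  (`|\det (\matrix_i u i)|%:E <= n`!%:R%:E * rvol K)%E.
Proof.
move=> cK vK [w Kw] Ka; set U := \matrix_i u i.
have [uU|] := boolP (U \in unitmx); last first.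
  rewrite unitmxE unitfE negbK => /eqP ->; rewrite normr0.
  by rewrite mule_ge0 ?rvol_ge0 ?lee_fin.
have uU' : invmx U \in unitmx by rewrite unitmx_inv.
have dU : 0 < `|\det U| by rewrite normr_gt0 -unitfE -unitmxE.
have : (1 <= n`!%:R%:E * rvol (linear_image (invmx U) K))%E.
  apply: (@rvol_ge_segments R n _ (fun i => a i *m invmx U)).
  - exact: compact_linear_image.
  - exact: convex_linear_image.
  - by exists (w *m invmx U), w.
  - move=> i; have [Ka1 Ka2] := Ka i; split; first by exists (a i).
    exists (a i + u i) => //; rewrite mulmxDl; congr (_ + _).
    have -> : u i = row i U by rewrite rowK.
    by rewrite -row_mul mulmxV // row1.
rewrite rvol_linear_image // -(@lee_pmul2l _ `|\det U|%:E) ?lte_fin // mule1.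
move/le_trans; apply; rewrite muleCA -[leRHS]mul1e muleA muleA muleC -muleA.
by rewrite -EFinM -normrM -det_mulmx mulmxV // det1 normr1 mulr1 mul1e muleC.
Qed.

Definition corner_simplex n : set 'rV[R]_n :=
  [set x | (forall i, 0 <= x 0 i) /\ \sum_i x 0 i <= 1].
Arguments corner_simplex : clear implicits.

(** The height is the first coordinate [x 0 0], and the base point is the rest divided by
    [1 - x 0 0]. If the height is 1, the rest is 0 and so is the quotient, by convention. *)
Lemma corner_simplexS n : corner_simplex n.+1 = cone_over 0 (corner_simplex n).
Proof.
apply/seteqP; split => [x [x0 x1]|_ [t [q [/andP[t0 t1] [q0 q1] ->]]]].
  rewrite big_ord_recl in x1.
  have s0 : 0 <= \sum_(i < n) x 0 (lift ord0 i) by apply: sumr_ge0.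
  have t1 : x 0 0 <= 1 by apply: le_trans x1; rewrite lerDl.
  have tE : \sum_(i < n) x 0 (lift ord0 i) <= 1 - x 0 0 by rewrite lerBrDl.
  exists (x 0 0), (\row_i (x 0 (lift ord0 i) / (1 - x 0 0))); split.
  - by rewrite x0.
  - split=> [i|]; first by rewrite mxE divr_ge0 // subr_ge0.
    under eq_bigr do rewrite mxE; rewrite -mulr_suml.
    have [->|t1'] := eqVneq (1 - x 0 0) 0; first by rewrite invr0 mulr0.
    by rewrite ler_pdivrMr ?mul1r // lt_neqAle eq_sym t1' subr_ge0.
  - apply/rowP => i; case: (splitP (i : 'I_(1 + n))) => l il.
      have -> : i = lshift n l by apply/val_inj.
      rewrite (@row_mxEl _ 1 1 n) (ord1 l) !mxE /= mulr1n.
      by congr (x _ _); apply/val_inj.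
    have -> : i = rshift 1 l by apply/val_inj.
    rewrite (@row_mxEr _ 1 1 n) !mxE mulr0 add0r.
    have -> : rshift 1 l = lift ord0 l by apply/val_inj.
    have [t1'|t1'] := eqVneq (1 - x 0 0) 0; last by rewrite mulrC divfK.
    rewrite t1' mul0r; apply/eqP; rewrite eq_le x0 andbT -t1'.
    apply: le_trans tE; rewrite (bigD1 l) //= lerDl; apply: sumr_ge0 => k _; exact: x0.
have H l : (row_mx t%:M (t *: 0 + (1 - t) *: q) : 'rV_(1 + n)) 0 (lift ord0 l) = (1 - t) * q 0 l.
  have -> : lift ord0 l = rshift 1 l by apply/val_inj.
  by rewrite (@row_mxEr _ 1 1 n) !mxE mulr0 add0r.
have H0 : (row_mx t%:M (t *: 0 + (1 - t) *: q) : 'rV_(1 + n)) 0 ord0 = t.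
  have -> : ord0 = lshift n (0 : 'I_1) by apply/val_inj.
  by rewrite (@row_mxEl _ 1 1 n) !mxE mulr1n.
split => [i|].
  by case: (unliftP ord0 i) => [l ->|->]; rewrite ?H ?H0 // mulr_ge0 // subr_ge0.
rewrite big_ord_recl H0; under eq_bigr do rewrite H; rewrite -mulr_sumr.
by rewrite -lerBrDl ler_piMr // subr_ge0.
Qed.

Lemma compact_corner_simplex n : compact (corner_simplex n).
Proof.
elim: n => [|n IH]; last by rewrite corner_simplexS; exact: compact_cone.
rewrite (_ : corner_simplex 0 = [set 0]); first exact: compact_set1.
apply/seteqP; split => [x _|x _]; first by apply/rowP => -[].
by split => [[]//|]; rewrite big_ord0.
Qed.

Lemma rvol_corner_simplex n : (n`!%:R%:E * rvol (corner_simplex n) = 1)%E.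
Proof.
elim: n => [|n IH].
  rewrite fact0 mul1e /rvol /= diracE mem_set //.
  by split => [[]//|]; rewrite big_ord0.
rewrite factS natrM mulrC EFinM -muleA corner_simplexS rvol_cone //.
exact: compact_corner_simplex.
Qed.

(** Induction on the list: the first point is combined with the remaining sum divided by [1 - x a].
    If [x a = 1], all other weights are 0. *)
Lemma convex_combination n I (r : seq I) (K : set 'rV[R]_n) (x : I -> R) (u : I -> 'rV[R]_n) :
  convex_set K -> K 0 -> (forall i, K (u i)) -> (forall i, 0 <= x i) ->
  \sum_(i <- r) x i <= 1 -> K (\sum_(i <- r) x i *: u i).
Proof.
move=> cK K0 Ku; elim: r x => [|a r IH] x x0; first by rewrite !big_nil.
rewrite !big_cons => x1.
have s0 : 0 <= \sum_(i <- r) x i by apply: sumr_ge0.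
have t1 : x a <= 1 by apply: le_trans x1; rewrite lerDl.
have tE : \sum_(i <- r) x i <= 1 - x a by rewrite lerBrDl.
have [t1'|t1'] := eqVneq (1 - x a) 0.
  have s00 : \sum_(i <- r) x i = 0 by apply/eqP; rewrite eq_le s0 andbT -[leRHS]t1'.
  suff -> : \sum_(i <- r) x i *: u i = 0.
    by rewrite addr0 (_ : x a = 1) ?scale1r //; apply/esym/eqP; rewrite -subr_eq0 -t1'.
  elim: r {IH x1 s0 tE} s00 => [|b r IH]; first by rewrite !big_nil.
  have sb : 0 <= \sum_(i <- r) x i by apply: sumr_ge0.
  rewrite !big_cons => /eqP; rewrite paddr_eq0 // => /andP[/eqP -> /eqP /IH ->].
  by rewrite scale0r addr0.
have -> : \sum_(i <- r) x i *: u i = (1 - x a) *: \sum_(i <- r) (x i / (1 - x a)) *: u i.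
  rewrite scaler_sumr; apply: eq_bigr => i _; rewrite scalerA mulrC divfK //.
apply: convex_comb => //; first by rewrite x0.
apply: IH => [i|]; first by rewrite divr_ge0 // subr_ge0.
by rewrite -mulr_suml ler_pdivrMr ?mul1r // lt_neqAle eq_sym t1' subr_ge0.
Qed.

Lemma convex_corner_simplex n : convex_set (corner_simplex n).
Proof.
move=> x y l /set_mem[x0 x1] /set_mem[y0 y1]; apply/mem_set.
have l0 : 0 <= l%:num by exact: ge0.
have l1 : 0 <= 1 - l%:num by rewrite subr_ge0; exact: le1.
split => [i|]; first by rewrite !mxE addr_ge0 // mulr_ge0.
under eq_bigr do rewrite !mxE; rewrite big_split /= -!mulr_sumr.
have := lerD (ler_wpM2l l0 x1) (ler_wpM2l l1 y1).
by rewrite !mulr1 subrKC.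
Qed.

Lemma conv_hull_simplex n (u : 'I_n -> 'rV[R]_n) :
  conv_hull ([set 0] `|` range u) = linear_image (\matrix_i u i) (corner_simplex n).
Proof.
apply/seteqP; split.
  apply: smallest_sub; first by apply: convex_linear_image; exact: convex_corner_simplex.
  move=> _ [->|[i _ <-]].
    by exists 0; rewrite ?mul0mx //; split => [i|]; rewrite ?mxE // big1 // => i _; rewrite mxE.
  exists (delta_mx 0 i); last by rewrite -rowE rowK.
  split => [j|]; first by rewrite mxE ler0n.
  by rewrite (bigD1 i) //= big1 ?mxE ?eqxx ?addr0 // => j ji; rewrite mxE (negPf ji) andbF.
move=> _ [x [x0 x1] <-] K [cK uK].
rewrite mulmx_sum_row; under eq_bigr do rewrite rowK.
apply: convex_combination => //; first by apply: uK; left.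
by move=> i; apply: uK; right; exists i.
Qed.

(** Column operations [B] annihilate the last column of [A], so the image lies in the preimage under
    [B] of a coordinate hyperplane, a null set. *)
Lemma rvol_singular_image n (A : 'M[R]_n) K : A \notin unitmx -> compact K ->
  rvol (linear_image A K) = 0%E.
Proof.
case: n A K => [|n] A K nA cK.
  by move: nA; rewrite unitmxE det_mx00 unitr1.
pose B := invmx (row_ebase A).
have uB : B \in unitmx by rewrite unitmx_inv row_ebase_unit.
have AB0 i : (A *m B) i ord_max = 0.
  rewrite -[A in A *m B]mulmx_ebase /B mulmxK ?row_ebase_unit // mxE big1 // => k _.
  rewrite !mxE [X in nat_of_bool X](_ : _ = false) ?mulr0 //; apply/negbTE.
  move: nA; rewrite -row_full_unit /row_full negb_and -leqNgt => rA.
  have [kn|//] := eqVneq; rewrite /= kn.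
  by have := rank_leq_row A; rewrite leq_eqVlt (negPf rA) ltnS.
pose Z (i : 'I_n.+1) : set (measurableTypeR R) := if i == ord_max then [set 0] else setT.
have mZ i : measurable (Z i) by rewrite /Z; case: ifP.
pose H := [set v : 'rV[R]_n.+1 | forall i, Z i (v 0 i)].
have mH : rmeas H by exact: (rmeas_box mZ).
have H0 : rvol H = 0%E.
  by rewrite rvol_box // (bigD1 ord_max) //= /Z eqxx lebesgue_measure_set1 mul0e.
have HB0 : rvol [set v | H (v *m B)] = 0%E.
  have dB : \det B != 0 by rewrite -unitfE -unitmxE.
  have /eqP := rvol_linear uB mH.
  by rewrite H0 mule_eq0 eqe normr_eq0 (negPf dB) => /eqP.
apply/eqP; rewrite eq_le rvol_ge0 andbT -HB0; apply: le_rvol.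
- by apply: compact_rmeas; exact: compact_linear_image.
- exact: rmeas_linear.
move=> _ [x Kx <-] i /=; rewrite /Z; case: ifP => // /eqP ->.
by rewrite -mulmxA mxE big1 // => k _; rewrite AB0 mulr0.
Qed.

Lemma vol_linear_image n (A : 'M[R]_n) K : compact K ->
  vol (linear_image A K) = `|\det A| * vol K.
Proof.
move=> cK; rewrite /vol -!/(rvol _).
have [uA|nA] := boolP (A \in unitmx).
  by rewrite rvol_linear_image // fineM // compact_rvol_fin.
rewrite rvol_singular_image //; move: nA; rewrite unitmxE unitfE negbK => /eqP ->.
by rewrite normr0 mul0r.
Qed.

Lemma vol_corner_simplex n : vol (corner_simplex n) = n`!%:R^-1.
Proof.
have := rvol_corner_simplex n; have := compact_rvol_fin (@compact_corner_simplex n).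
rewrite /vol -/(rvol _); case: (rvol _) => // r _; rewrite -EFinM => -[H] /=.
by apply: (mulfI (_ : n`!%:R != 0)); rewrite ?H ?divff // pnatr_eq0 -lt0n fact_gt0.
Qed.

(** In full dimension the admissible frames are orthogonal matrices, which preserve volume. *)
Lemma vol_sub_full n (S : set 'rV[R]_n) : compact S -> vol_sub n S = vol S.
Proof.
move=> cS; rewrite /vol_sub (_ : [set _ | _ in _] = [set vol S]) ?sup1 //.
have key (E : 'M[R]_n) : E *m E^T = 1%:M -> vol [set y | S (y *m E)] = vol S.
  move=> EE; have dE : `|\det E| = 1.
    have := congr1 (fun M => \det M) EE; rewrite det_mulmx det_tr det1 -expr2 => d2.
    by apply/eqP; rewrite -sqrp_eq1 // real_normK ?num_real // d2.
  have uE : E \in unitmx by rewrite unitmxE unitfE -normr_eq0 dE oner_eq0.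
  by rewrite /vol -!/(rvol _) -(rvol_linear uE (compact_rmeas cS)) dE mul1e.
apply/seteqP; split => [_ [E [EE _] <-]|_ ->]; first exact: key.
exists 1%:M; last by rewrite key // trmx1 mulmx1.
by split; [rewrite trmx1 mulmx1|move=> x _; exists x => //; rewrite mulmx1].
Qed.

Lemma vol_sub_simplex n (u : 'I_n -> 'rV[R]_n) :
  vol_sub n (conv_hull ([set 0] `|` range u)) = `|\det (\matrix_i u i)| / n`!%:R.
Proof.
have cS := @compact_corner_simplex n.
rewrite conv_hull_simplex vol_sub_full; last exact: compact_linear_image.
by rewrite vol_linear_image // vol_corner_simplex.
Qed.

End simplices.

(** * Bodies in Behrend position *)

Section euclidean_norm.
Context {R : realType}.

Lemma sqr_enorm n (x : 'rV[R]_n) : enorm x ^+ 2 = \sum_i x 0 i ^+ 2.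
Proof. by rewrite sqr_sqrtr // sumr_ge0 // => i _; rewrite sqr_ge0. Qed.

Lemma enorm_ge0 n (x : 'rV[R]_n) : 0 <= enorm x.
Proof. exact: sqrtr_ge0. Qed.

Lemma enormZ n (a : R) (x : 'rV[R]_n) : enorm (a *: x) = `|a| * enorm x.
Proof.
rewrite /enorm; under eq_bigr do rewrite mxE exprMn.
by rewrite -mulr_sumr sqrtrM ?sqr_ge0 // sqrtr_sqr.
Qed.

Lemma enorm_delta n i : enorm (delta_mx 0 i : 'rV[R]_n) = 1.
Proof.
rewrite /enorm (bigD1 i) //= big1 => [|j ji].
  by rewrite mxE !eqxx expr1n addr0 sqrtr1.
by rewrite mxE (negPf ji) andbF expr0n.
Qed.

Lemma enorm_gt0 n (x : 'rV[R]_n) : x != 0 -> 0 < enorm x.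
Proof.
move=> x0; rewrite lt_neqAle enorm_ge0 andbT eq_sym -sqrf_eq0 sqr_enorm.
apply: contraNneq x0 => /eqP; rewrite psumr_eq0 => [/allP x0|i _]; last exact: sqr_ge0.
apply/eqP/rowP => i; rewrite mxE; apply/eqP; rewrite -sqrf_eq0.
exact: x0 (mem_index_enum _).
Qed.

Lemma continuous_sqr_enorm n : continuous (fun x : 'rV[R]_n => enorm x ^+ 2).
Proof.
under eq_fun do rewrite sqr_enorm.
apply: continuous_sumr => i x; rewrite /GRing.exp /=; apply: continuousM; exact: coord_continuous.
Qed.

Lemma continuous_enorm n : continuous (@enorm R n).
Proof.
move=> x; apply: (@continuous_comp _ _ _ (fun x : 'rV[R]_n => \sum_i x 0 i ^+ 2) Num.sqrt).
  have := @continuous_sqr_enorm n x; under eq_fun do rewrite sqr_enorm.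
  exact.
exact: sqrt_continuous.
Qed.

Definition difference_set n (K : set 'rV[R]_n) : set 'rV[R]_n :=
  [set x.1 - x.2 | x in K `*` K].

Lemma compact_difference_set n (K : set 'rV[R]_n) : compact K -> compact (difference_set K).
Proof.
move=> cK; apply: continuous_compact; last exact: compact_setX.
apply: continuous_subspaceT => x; apply: cvgB; [exact: cvg_fst|exact: cvg_snd].
Qed.

Lemma diamE n (K : set 'rV[R]_n) : diam K = sup (@enorm R n @` difference_set K).
Proof.
rewrite /diam; congr sup; apply/seteqP; split => [_ [x Kx [y Ky <-]]|_ [_ [[x y] [Kx Ky] <-] <-]].
  by exists (x - y) => //; exists (x, y).
by exists x => //; exists y.
Qed.

Lemma enorm_le_diam n (K : set 'rV[R]_n) d :
  compact K -> difference_set K d -> enorm d <= diam K.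
Proof.
move=> cK Kd; rewrite diamE; apply: ub_le_sup; last by exists d.
have /compact_has_sup[] // : compact (@enorm R n @` difference_set K).
  apply: continuous_compact; last exact: compact_difference_set.
  by apply: continuous_subspaceT; exact: continuous_enorm.
by exists (enorm d), d.
Qed.

Lemma diam_attained n (K : set 'rV[R]_n) : compact K -> K !=set0 ->
  exists2 d, difference_set K d & enorm d = diam K.
Proof.
move=> cK [w Kw]; have D0 : difference_set K !=set0 by exists (w - w), (w, w).
have ce : {within difference_set K, continuous (@enorm R n)}.
  by apply: continuous_subspaceT; exact: continuous_enorm.
have [d /set_mem Dd dmax] := compact_EVT_max D0 (compact_difference_set cK) ce.
exists d => //; apply/eqP; rewrite eq_le enorm_le_diam //= diamE.
apply: ge_sup; first by exists (enorm d), d.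
by move=> _ [e De <-]; apply: dmax; exact: mem_set.
Qed.

(** Short segments in all coordinate directions witness that volume and diameter are positive. *)
Lemma interior_segments n (K : set 'rV[R]_n) : K° !=set0 ->
  exists w, K w /\ exists2 e : R, 0 < e & forall i, K (w + e *: delta_mx 0 i).
Proof.
move=> [w Kw]; exists w; split; first exact: interior_subset Kw.
have /nbhs_ballP[e /= e0 eK] := Kw; exists (e / 2); first by rewrite divr_gt0.
move=> i; apply: eK; split => // k j; rewrite /ball /= !mxE opprD addrA subrr sub0r normrN.
rewrite normrM (ger0_norm (_ : 0 <= e / 2)); last by rewrite divr_ge0 // ltW.
have : `|((k == 0) && (j == i))%:R| <= 1 :> R by case: (_ && _); rewrite ?normr1 ?normr0.
move=> H; apply: le_lt_trans (_ : e / 2 * 1 < e); first by rewrite ler_pM2l // divr_gt0.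
by rewrite mulr1; lra.
Qed.

Lemma convex_body_vol_gt0 n (K : set 'rV[R]_n) : convex_body K -> 0 < vol K.
Proof.
move=> [cK vK /interior_segments[w [Kw [e e0 Ke]]]].
have := @rvol_ge_directions R n K (fun=> w) (fun i => e *: delta_mx 0 i) cK vK (ex_intro _ w Kw)
  (fun i => conj Kw (Ke i)).
have -> : \matrix_i (e *: delta_mx 0 i) = e%:M :> 'M[R]_n.
  apply/matrixP => i j; rewrite !mxE eqxx /= eq_sym; case: eqP; rewrite ?mulr1 ?mulr0 //.
rewrite det_scalar gtr0_norm ?exprn_gt0 // /vol -/(rvol K).
have := compact_rvol_fin cK; case: (rvol K) => // r _; rewrite lee_fin /=.
move/(lt_le_trans (exprn_gt0 n e0)); rewrite pmulr_rgt0 // ltr0n fact_gt0 //.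
Qed.

Lemma convex_body_diam_gt0 n (K : set 'rV[R]_n) : (0 < n)%N -> convex_body K -> 0 < diam K.
Proof.
move=> n0 [cK vK /interior_segments[w [Kw [e e0 Ke]]]].
apply: lt_le_trans (_ : enorm (e *: delta_mx 0 (Ordinal n0)) <= _).
  by rewrite enormZ enorm_delta mulr1 gtr0_norm.
apply: enorm_le_diam => //; exists (w + e *: delta_mx 0 (Ordinal n0), w) => //=.
by rewrite addrC addKr.
Qed.

End euclidean_norm.

(** * Perturbation of determinants and of norms *)

Section perturbation.
Context {R : realType}.

Lemma horner_char_poly n (A : 'M[R]_n) x : (char_poly A).[x] = \det (x%:M - A).
Proof.
rewrite -[LHS]/(horner_eval x _) /char_poly -det_map_mx; congr (\det _).
by apply/matrixP => i j; rewrite !mxE /= /horner_eval hornerD hornerN hornerC hornerMn hornerX.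
Qed.

(* The derivative of the determinant at e = 0 is the trace; both are read off the
   characteristic polynomial of - H. *)
Lemma det_1D_gt1 n (H : 'M[R]_n) : 0 < \tr H ->
  \forall e \near (0 : R), 0 < e -> 1 < \det (1%:M + e *: H).
Proof.
case: n H => [|n] H tH; first by move: tH; rewrite /mxtrace big_ord0 ltxx.
pose p : {poly R} := char_poly (- H); pose c (k : nat) : R := p`_k.
(* For nonzero e, det (1 + e H) = e^(n+1) p(1/e). The leading coefficient of [p] contributes 1 and
   the others contribute [e * s e]. *)
pose s (e : R) := \sum_(k < n.+1) c k * e ^+ (n - k).
have s0 : s 0 = \tr H.
  rewrite /s big_ord_recr /= subnn expr0 mulr1 big1 => [|k _].
    by rewrite add0r /c (char_poly_trace (- H) (ltn0Sn n)) raddfN opprK.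
  by rewrite expr0n subn_eq0 leqNgt ltn_ord mulr0.
have cs : {for (0 : R), continuous s}.
  apply: continuous_sumr => k x.
  apply: (@continuousM R R (fun=> c k) (fun y : R => y ^+ (n - k))); first exact: cst_continuous.
  exact: exprn_continuous.
have detE e : e != 0 -> \det (1%:M + e *: H) = 1 + e * s e.
  move=> e0; have -> : 1%:M + e *: H = e *: (e^-1%:M - - H).
    by rewrite opprK scalerDr scale_scalar_mx divff.
  rewrite detZ -horner_char_poly horner_coef size_char_poly big_ord_recr /=.
  have := char_poly_monic (- H); rewrite monicE lead_coefE size_char_poly => /eqP -> /=.
  rewrite mul1r mulrDr -exprMn divff // expr1n addrC; congr (_ + _).
  rewrite /s !mulr_sumr; apply: eq_bigr => k _; rewrite mulrCA [RHS]mulrCA -/p; congr (_ * _).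
  have -> : e ^+ n.+1 = e * e ^+ (n - k) * e ^+ k.
    by rewrite -mulrA -exprD subnK ?leq_ord // -exprS.
  by rewrite exprVn mulfK ?expf_neq0.
have := cvgr_gt _ cs; rewrite s0 => /(_ _ 0 tH); apply: filterS => e se e0.
by rewrite detE ?gt_eqF // ltrDl mulr_gt0.
Qed.

(* Where |d| < r the perturbed norm stays below r by continuity; where |d| = r
   its derivative in e is negative. *)
Lemma enorm_perturb_le n (H : 'M[R]_n) (S : set 'rV[R]_n) (r : R) :
  0 <= r -> compact S -> (forall d, S d -> enorm d <= r) ->
  (forall d, S d -> enorm d = r -> (d *m H *m d^T) 0 0 < 0) ->
  \forall e \near (0 : R), 0 < e ->
    forall d, S d -> enorm (d *m (1%:M + e *: H)) <= r.
Proof.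
move=> r0 cS Sr SH.
have expand d e : enorm (d *m (1%:M + e *: H)) ^+ 2 =
    enorm d ^+ 2 + e * (2 * (d *m H *m d^T) 0 0 + e * enorm (d *m H) ^+ 2).
  rewrite !sqr_enorm mulmxDr mulmx1 -scalemxAr [(_ *m _^T) _ _]mxE.
  rewrite mulr_sumr mulr_sumr -big_split mulr_sumr -big_split /=.
  by apply: eq_bigr => i _; rewrite !mxE; ring.
have cfst : continuous (fst : 'rV[R]_n * R -> 'rV[R]_n) by move=> p; exact: cvg_fst.
have cH : continuous (fun d : 'rV[R]_n => d *m H) := @continuous_mulmx R 1 n n H.
have cN : continuous (fun d : 'rV[R]_n => enorm (d *m H) ^+ 2).
  by move=> d; exact: (continuous_comp (cH d) (@continuous_sqr_enorm R n _)).
have cT i : continuous (fun d : 'rV[R]_n => d^T i 0).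
  by under eq_fun do rewrite mxE; exact: coord_continuous.
have cQ : continuous (fun d : 'rV[R]_n => (d *m H *m d^T) 0 0).
  under eq_fun do rewrite mxE; apply: continuous_sumr => i d.
  apply: (@continuousM R _ (fun d : 'rV[R]_n => (d *m H) 0 i) (fun d : 'rV[R]_n => d^T i 0)).
    exact: (continuous_comp (cH d) (@coord_continuous R 1 n 0 i _)).
  exact: cT.
(* The difference quotient in [e] of the squared perturbed norm; continuity in both variables makes
   its sign stable near [(d, 0)]. *)
pose G (p : 'rV[R]_n * R) := 2 * (p.1 *m H *m p.1^T) 0 0 + p.2 * enorm (p.1 *m H) ^+ 2.
have cG : continuous G.
  move=> p; apply: cvgD.
    apply: cvgM; first exact: cvg_cst.
    exact: (continuous_comp (cfst p) (cQ _)).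
  by apply: cvgM; [exact: cvg_snd|exact: (continuous_comp (cfst p) (cN _))].
pose F (p : 'rV[R]_n * R) := enorm p.1 ^+ 2 + p.2 * G p.
have cF : continuous F.
  move=> p; apply: cvgD; last by apply: cvgM; [exact: cvg_snd|exact: cG].
  exact: (continuous_comp (cfst p) (@continuous_sqr_enorm R n _)).
(* Compactness turns the estimates near each [d] into one range of [e] valid on all of [S]. *)
have /compact_near_coveringP/near_covering_withinP cover := cS.
have : \forall e \near (0 : R), S `<=`
    (fun d => 0 < e -> enorm (d *m (1%:M + e *: H)) <= r).
  apply: (cover R (nbhs (0 : R))
    (fun e d => 0 < e -> enorm (d *m (1%:M + e *: H)) <= r)) => d Sd.
  have [dr|dr] := eqVneq (enorm d) r.
    have G0 : G (d, 0) < 0 by rewrite /G /= mul0r addr0 pmulr_rlt0 // SH.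
    have := cvgr_lt _ (cG (d, 0)) => /(_ _ 0 G0); apply: filterS => -[d' e] /= Gp Sd' e0.
    rewrite -ler_sqr ?nnegrE ?enorm_ge0 // expand -/(G (d', e)).
    rewrite -[leRHS]addr0 lerD ?ler_sqr ?nnegrE ?enorm_ge0 ?Sr //.
    by rewrite pmulr_rle0 // ltW.
  have F0 : F (d, 0) < r ^+ 2.
    by rewrite /F /= mul0r addr0 ltr_sqr ?nnegrE ?enorm_ge0 // lt_neqAle dr Sr.
  have := cvgr_lt _ (cF (d, 0)) => /(_ _ _ F0); apply: filterS => -[d' e] /= Fp Sd' e0.
  by rewrite -ler_sqr ?nnegrE ?enorm_ge0 // expand ltW.
by apply: filterS => e He e0 d /He; exact.
Qed.

End perturbation.

(** * Decomposition of the identity along diameters *)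

Section decomposition.
Context {R : realType}.

Lemma mxtrace_outer_sum n m (c : 'I_m -> R) (d : 'I_m -> 'rV[R]_n) :
  \tr (outer_sum c d) = \sum_i c i * enorm (d i) ^+ 2.
Proof.
rewrite /outer_sum raddf_sum /=; apply: eq_bigr => i _.
rewrite mxtraceZ sqr_enorm; congr (_ * _); apply: eq_bigr => k _.
by rewrite mxE big_ord1 mxE expr2.
Qed.

Lemma frob_diag_ge n (X : 'M[R]_n) k : X k k ^+ 2 <= frob X X.
Proof.
rewrite /frob (bigD1 k) //= (bigD1 k) //= -expr2 -addrA lerDl addr_ge0 //.
  by apply: sumr_ge0 => l _; rewrite -expr2 sqr_ge0.
by apply: sumr_ge0 => j _; apply: sumr_ge0 => l _; rewrite -expr2 sqr_ge0.
Qed.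

(* Far from the origin of the cone the diagonal is too large to compete with 0. *)
Lemma frob_outer_sum_far n m (c : 'I_m -> R) (d : 'I_m -> 'rV[R]_n) r i :
  0 < r -> (forall i, 0 <= c i) -> (forall i, enorm (d i) = r) ->
  n%:R * n.+1%:R / r ^+ 2 < c i ->
  frob (1%:M : 'M[R]_n) 1%:M <= frob (1%:M - outer_sum c d) (1%:M - outer_sum c d).
Proof.
move=> r0 c0 dr ci; set M := outer_sum c d.
have tM : n%:R * n.+1%:R < \tr M.
  rewrite mxtrace_outer_sum (bigD1 i) //= dr; apply: lt_le_trans (_ : c i * r ^+ 2 <= _).
    by rewrite -ltr_pdivrMr // exprn_gt0.
  by rewrite lerDl sumr_ge0 // => j _; rewrite mulr_ge0 ?sqr_ge0.
(* A trace above n (n + 1) forces a diagonal entry above n + 1, at distance more than n from 1. *)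
have [k Mk] : exists k, n.+1%:R < M k k.
  apply/existsP; apply: contraLR tM; rewrite negb_exists => /forallP Mk.
  rewrite -leNgt /mxtrace mulrC mulr_natr -[X in _ *+ X](card_ord n) -sumr_const.
  by apply: ler_sum => k _; rewrite leNgt.
apply: le_trans (frob_diag_ge _ k); rewrite frob1 mxtrace1.
have -> : (1%:M - M) k k = 1 - M k k by rewrite mxE [in LHS]mxE [(- M) k k]mxE eqxx.
rewrite -sqrrN opprB; move: Mk; rewrite -natr1 => Mk; have n0 := ler0n R n.
apply: (@le_trans _ _ (n%:R ^+ 2)).
  by rewrite -natrX ler_nat; case: (n) => // q; rewrite -mulnn leq_pmulr.
by rewrite ler_sqr ?nnegrE //; lra.
Qed.

Lemma continuous_frob_outer_sum (X : topologicalType) n m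
    (c : 'I_m -> X -> R) (d : 'I_m -> X -> 'rV[R]_n) :
  (forall i, continuous (c i)) -> (forall i, continuous (d i)) ->
  continuous (fun p => frob (1%:M - outer_sum (c^~ p) (d^~ p))
                            (1%:M - outer_sum (c^~ p) (d^~ p))).
Proof.
move=> cc cd.
have cdk i k : continuous (fun p => d i p 0 k).
  by move=> p; exact: (continuous_comp (cd i p) (@coord_continuous R 1 n 0 k _)).
have ccoord k l : continuous (fun p => (1%:M - outer_sum (c^~ p) (d^~ p)) k l).
  have -> : (fun p => (1%:M - outer_sum (c^~ p) (d^~ p)) k l) =
      (fun p => (1%:M : 'M[R]_n) k l - \sum_i c i p * (d i p 0 k * d i p 0 l)).
    apply/funext => p; rewrite !mxE /outer_sum summxE; congr (_ - _).
    by apply: eq_bigr => i _; rewrite !mxE big_ord1 !mxE.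
  move=> p; apply: cvgB; first exact: cvg_cst.
  apply: (@continuous_sumr R X) => i {}p; apply: (@continuousM R X); first exact: cc.
  by apply: (@continuousM R X); exact: cdk.
apply: continuous_sumr => k; apply: continuous_sumr => l p.
by apply: (@continuousM R X); exact: ccoord.
Qed.

(** With the number of summands fixed, the families with coefficients in [[0, b]] form a compact
    set. A family with a coefficient above [b] is no better than the zero combination, which belongs
    to that set. *)
Lemma exists_nearest_outer_sum n m (D : set 'rV[R]_n) (r : R) :
  0 < r -> compact D -> D !=set0 -> (forall d, D d -> enorm d = r) ->
  exists c : 'I_m -> R, exists d : 'I_m -> 'rV[R]_n,
    [/\ forall i, 0 <= c i, forall i, D (d i) &
    forall (c' : 'I_m -> R) (d' : 'I_m -> 'rV[R]_n),
      (forall i, 0 <= c' i) -> (forall i, D (d' i)) ->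
      frob (1%:M - outer_sum c d) (1%:M - outer_sum c d) <=
      frob (1%:M - outer_sum c' d') (1%:M - outer_sum c' d')].
Proof.
move=> r0 cD [e De] Dr; pose b : R := n%:R * n.+1%:R / r ^+ 2.
have b0 : 0 <= b by rewrite divr_ge0 ?sqr_ge0 ?mulr_ge0.
pose X := prod_topology (fun _ : 'I_m => (R * 'rV[R]_n)%type).
pose A : set X := [set p : X | forall i, (`[0, b] `*` D) (p i)].
have cA : compact A.
  apply: (@tychonoff 'I_m (fun=> (R * 'rV[R]_n)%type) (fun=> `[0, b] `*` D)) => i.
  by apply: compact_setX => //; exact: segment_compact.
have A0 : A !=set0 by exists (fun=> (0, e)) => i; split => //=; rewrite in_itv /= lexx.
pose f (p : X) := frob (1%:M - outer_sum (fun i => (p i).1) (fun i => (p i).2))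
  (1%:M - outer_sum (fun i => (p i).1) (fun i => (p i).2)).
have cf : continuous f.
  have cp i : continuous (fun p : X => p i).
    exact: (@proj_continuous 'I_m (fun=> (R * 'rV[R]_n)%type) i).
  have c1 i : continuous (fun p : X => (p i).1).
    have cf : continuous (fst : R * 'rV[R]_n -> R) by move=> q; exact: cvg_fst.
    by move=> p; exact: (continuous_comp (cp i p) (cf _)).
  have c2 i : continuous (fun p : X => (p i).2).
    have cf : continuous (snd : R * 'rV[R]_n -> 'rV[R]_n) by move=> q; exact: cvg_snd.
    by move=> p; exact: (continuous_comp (cp i p) (cf _)).
  exact: (continuous_frob_outer_sum c1 c2).
have [p /set_mem Ap pmin] := compact_EVT_min A0 cA (continuous_subspaceT cf).
exists (fun i => (p i).1), (fun i => (p i).2); split.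
- by move=> i; have [] := Ap i; rewrite /= in_itv /= => /andP[].
- by move=> i; have [] := Ap i.
move=> c' d' c'0 Dd'.
have [c'b|] := boolP [forall i, c' i <= b].
  apply: (pmin (fun i => (c' i, d' i) : R * 'rV[R]_n)); apply/mem_set => i; split => //=.
  by rewrite in_itv /= c'0 (forallP c'b i).
rewrite negb_forall => /existsP[i]; rewrite -ltNge => c'i.
apply: le_trans (frob_outer_sum_far r0 c'0 (fun i => Dr _ (Dd' i)) c'i).
apply: le_trans (pmin (fun=> (0, e)) _) _.
  by apply/mem_set => j; split => //=; rewrite in_itv /= lexx.
by rewrite /f /outer_sum big1 ?subr0 // => j _; rewrite scale0r.
Qed.

Lemma behrend_decomposition n (K : set 'rV[R]_n) :
  (0 < n)%N -> convex_body K -> behrend_position K ->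
  exists (u : 'I_('C(n.+1, 2)) -> 'rV[R]_n) (l : 'I_('C(n.+1, 2)) -> R),
    [/\ forall i, enorm (u i) = 1, forall i, 0 <= l i,
        1%:M = \sum_i l i *: ((u i)^T *m u i) &
        forall i, exists2 a, K a & K (a + diam K *: u i)].
Proof.
move=> n0 bK behr; have D0 := convex_body_diam_gt0 n0 bK; set r := diam K in D0 *.
have [cK vK /interior_segments[w [Kw _]]] := bK.
have cS := compact_difference_set cK.
pose D : set 'rV[R]_n := difference_set K `&` [set d | enorm d = r].
have cD : compact D.
  apply: compact_closedI => //.
  rewrite (_ : [set d | _] = @enorm R n @^-1` [set r]) //.
  apply: closed_comp; last exact: closed_eq.
  by move=> x _; exact: continuous_enorm.
have [d0 Sd0 d0r] := diam_attained cK (ex_intro _ w Kw).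
have [c [d [c0 Dd cmin]]] := @exists_nearest_outer_sum n 'C(n.+1, 2) D r D0 cD
  (ex_intro _ d0 (conj Sd0 d0r)) (fun d Dd => Dd.2).
have [trH quadH] := nearest_outer_sum c0 Dd cmin.
set H := _ - _ in trH quadH; have [H0|Hn0] := eqVneq H 0.
  (* Normalising the diametral vectors moves the factor [r ^+ 2] into the coefficients. *)
  exists (fun i => r^-1 *: d i), (fun i => r ^+ 2 * c i); split.
  - by move=> i; rewrite enormZ (Dd i).2 gtr0_norm ?invr_gt0 // mulVf // gt_eqF.
  - by move=> i; rewrite mulr_ge0 ?sqr_ge0.
  - move/eqP: H0; rewrite subr_eq0 => /eqP ->; apply: eq_bigr => i _.
    rewrite -scalemxAr [(_ *: d i)^T]linearZ /= -scalemxAl !scalerA; congr (_ *: _).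
    by field; rewrite gt_eqF.
  - move=> i; have [[[x y] [/= Kx Ky] xyd] _] := Dd i; exists y => //.
    by rewrite scalerA divff ?gt_eqF // scale1r -xyd addrC subrK.
exfalso.
have trH0 : 0 < \tr H.
  apply: lt_le_trans trH; rewrite lt_neqAle frob_ge0 andbT eq_sym.
  by apply: contraNneq Hn0 => /frob_eq0 ->.
(* Subtracting [t] makes the form negative, and not only nonpositive, on the
   diametral directions, while the trace remains positive. *)
pose t := \tr H / (2 * n%:R); pose H' := H - t%:M.
have nR : n%:R != 0 :> R by rewrite pnatr_eq0 -lt0n.
have t0 : 0 < t by rewrite divr_gt0 // mulr_gt0 // ltr0n.
have trH' : 0 < \tr H'.
  rewrite /H' raddfB /= mxtrace_scalar -mulr_natr (_ : _ - _ = \tr H / 2) ?divr_gt0 //.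
  by rewrite /t; field.
have quadH' e : difference_set K e -> enorm e = r -> (e *m H' *m e^T) 0 0 < 0.
  move=> Se er; rewrite mulmxBr mulmxBl mxE [X in _ + X]mxE.
  have -> : (e *m t%:M *m e^T) 0 0 = t * r ^+ 2.
    rewrite mul_mx_scalar -scalemxAl mxE -er sqr_enorm; congr (_ * _).
    by rewrite mxE; apply: eq_bigr => i _; rewrite mxE expr2.
  have := quadH e (conj Se er); rewrite -/H => q0.
  by rewrite subr_lt0 (le_lt_trans q0) // mulr_gt0 // exprn_gt0.
have near1 := det_1D_gt1 trH'.
have near2 := enorm_perturb_le (ltW D0) cS (fun d Sd => enorm_le_diam cK Sd) quadH'.
have [eps /= eps0 Heps] := iffLR (nbhs_ballP _ _) (filterI near1 near2).
pose e := eps / 2; have e0 : 0 < e by rewrite divr_gt0.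
have [|det1 norm1] := Heps e.
  by rewrite /ball /= sub0r normrN gtr0_norm // /e; lra.
pose A := 1%:M + e *: H'.
have {}det1 : 1 < \det A by exact: det1.
have {}norm1 : forall d, difference_set K d -> enorm (d *m A) <= r by exact: norm1.
have uA : A \in unitmx by rewrite unitmxE unitfE gt_eqF // (lt_trans ltr01).
have SAK v : difference_set K v -> difference_set (linear_image A K) (v *m A).
  move=> [[x y] [/= Kx Ky] <-]; exists (x *m A, y *m A); last by rewrite /= mulmxBl.
  by split => /=; [exists x|exists y].
(* Positivity is required to compare the reciprocals of the two diameters. *)
have dA0 : 0 < diam (linear_image A K).
  have cAK : compact (linear_image A K) by exact: compact_linear_image.
  apply: lt_le_trans (enorm_le_diam cAK (SAK _ Sd0)).
  apply: enorm_gt0; apply: contraTneq D0 => d0A.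
  have -> : r = 0; last by rewrite ltxx.
  by rewrite -[LHS]d0r -(mulmxK uA d0) d0A mul0mx -(scale0r 0) enormZ normr0 mul0r.
have dA : diam (linear_image A K) <= r.
  rewrite diamE; apply: ge_sup; first by exists (enorm (d0 *m A)), (d0 *m A) => //; exact: SAK.
  move=> _ [_ [[_ _] [/= [x Kx <-] [y Ky <-]] <-] <-]; rewrite -mulmxBl.
  by apply: norm1; exists (x, y).
have := behr A uA; rewrite /idq vol_linear_image // leNgt => /negP; apply.
rewrite ger0_norm; last by rewrite ltW // (lt_trans ltr01).
have vK0 := convex_body_vol_gt0 bK.
apply: (@lt_le_trans _ _ (\det A * vol K / r ^+ n)).
  by rewrite ltr_pM2r ?invr_gt0 ?exprn_gt0 // ltr_pMl.
rewrite ler_pM2l; last by rewrite mulr_gt0 // (lt_trans ltr01).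
rewrite lef_pV2 ?posrE ?exprn_gt0 //.
by apply: lerXn2r; rewrite ?nnegrE // ltW.
Qed.

End decomposition.

(** [DR] asks for increasing indices while the large minor comes from an injective map. Only the
    range matters for the simplex, so the image is enumerated in order. *)
Lemma increasing_enumeration n N (f : 'I_n -> 'I_N) : injective f ->
  exists2 g : 'I_n -> 'I_N, {homo g : a b / (a < b)%N} & range g = range f.
Proof.
move=> fi; pose A := [set f i | i in [set: 'I_n]]%SET.
have cA : #|A| = n by rewrite /A card_imset // cardsT card_ord.
have sA : sorted ltn [seq val i | i <- enum A].
  apply: (subseq_sorted ltn_trans _ (iota_ltn_sorted 0 N)).
  rewrite -val_enum_ord; apply: map_subseq.
  by rewrite {1}/enum_mem -enumT; exact: filter_subseq.
pose g (i : 'I_n) : 'I_N := enum_val (cast_ord (esym cA) i).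
exists g => [i j ij|].
  have sz (k : 'I_n) : (k < size (enum A))%N by rewrite -cardE cA.
  have := @sorted_ltn_nth _ _ ltn_trans 0%N _ sA i j; rewrite !inE size_map.
  move=> /(_ (sz i) (sz j) ij); rewrite !(nth_map (f i)) //.
  by rewrite -!(enum_val_nth (f i) (cast_ord (esym cA) _)).
apply/seteqP; split => [_ [i _ <-]|_ [i _ <-]].
  have := enum_valP (cast_ord (esym cA) i); rewrite -/(g i) => /imsetP[j _ ->].
  by exists j.
have fA : f i \in A by apply/imsetP; exists i.
exists (cast_ord cA (enum_rank_in fA (f i))) => //.
by rewrite /g cast_ordK enum_rankK_in.
Qed.

(** * Comparison of [idq], [DR] and the explicit bound *)

Section identity_decompositions.
Context {R : realType}.

(** Segments of length proportional to the diameter contribute its [n]-th power to the determinant,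
    which cancels the denominator of [idq]. *)
Lemma le_idq_of_directions n (K : set 'rV[R]_n) (a u : 'I_n -> 'rV[R]_n) :
  (0 < n)%N -> convex_body K ->
  (forall i, K (a i) /\ K (a i + diam K *: u i)) ->
  `|\det (\matrix_i u i)| / n`!%:R <= idq K.
Proof.
move=> n0 bK Ka; have D0 := convex_body_diam_gt0 n0 bK; have [cK vK intK] := bK.
have Kn0 : K !=set0 by exists (a (Ordinal n0)); exact: (Ka _).1.
have := rvol_ge_directions cK vK Kn0 Ka.
have -> : \matrix_i (diam K *: u i) = diam K *: \matrix_i u i.
  by apply/matrixP => i j; rewrite !mxE.
rewrite detZ normrM (gtr0_norm (exprn_gt0 n D0)) /idq /vol -/(rvol K).
have := compact_rvol_fin cK; case: (rvol K) => // v _; rewrite lee_fin /= => H.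
rewrite ler_pdivrMr ?ltr0n ?fact_gt0 // mulrAC ler_pdivlMr ?exprn_gt0 //.
by rewrite mulrC (mulrC v).
Qed.

(* [DR m n j] is the supremum of this set. *)
Definition DR_bounds (m n j : nat) : set R := [set nu : R | 0 <= nu /\
    forall (u : 'I_m -> 'rV[R]_n) (lambda : 'I_m -> R),
      (forall i, enorm (u i) = 1) -> (forall i, 0 <= lambda i) ->
      1%:M = \sum_i lambda i *: ((u i)^T *m u i) ->
      exists2 f : 'I_j -> 'I_m, {homo f : a b / (a < b)%N} &
        nu <= vol_sub j (conv_hull ([set 0] `|` range (u \o f)))].

Lemma DR_bounds_le_idq n (K : set 'rV[R]_n) : (0 < n)%N -> convex_body K ->
  behrend_position K -> ubound (DR_bounds 'C(n.+1, 2) n n) (idq K).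
Proof.
move=> n0 bK behr nu [nu0 Hnu].
have [u [l [u1 l0 I1 seg]]] := behrend_decomposition n0 bK behr.
have [f _] := Hnu u l u1 l0 I1; rewrite vol_sub_simplex => /le_trans; apply.
have [a Ka] := choice (fun i => (let: ex_intro2 a Ka Ka' := seg i in
   ex_intro (fun a => K a /\ K (a + diam K *: u i)) a (conj Ka Ka'))).
by apply: (le_idq_of_directions (a := a \o f)) => // i; exact: Ka.
Qed.

Lemma bin2_half n : 'C(n.+1, 2) = ((n * n.+1) %/ 2)%N.
Proof. by rewrite bin2 divn2 mulnC. Qed.

Lemma natr_bin2S n : 'C(n.+1, 2)%:R = n%:R * n.+1%:R / 2 :> R.
Proof.
apply: (mulIf (_ : 2 != 0)) => //; rewrite divfK // -!natrM bin2 -divn2 divnK.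
  by rewrite mulnC.
by rewrite dvdn2 oddM /= andNb.
Qed.

Lemma sqr_powR_half (x : R) n : 0 <= x -> (x `^ (n%:R / 2)) ^+ 2 = x ^+ n.
Proof.
move=> x0; rewrite -powR_mulrn ?powR_ge0 // -powRrM divfK // powR_mulrn //.
Qed.

(** The weights sum to n, by taking traces, so their mean is n / C(n+1, 2) = 2 / (n + 1). The bound
    is the square root of what the large minor then guarantees, divided by n!. *)
Lemma idq_lower_bound_DR_bounds n : (0 < n)%N ->
  DR_bounds 'C(n.+1, 2) n n (idq_lower_bound R n).
Proof.
move=> n0; split; first by rewrite divr_ge0 ?powR_ge0 // mulr_ge0 ?sqrtr_ge0.
move=> u l u1 l0 I1.
have [f fi Hf] := exists_large_minor l0 I1.
have [g gmono gf] := increasing_enumeration fi; exists g => //.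
have -> : range (u \o g) = range (u \o f) by rewrite -(image_comp g u) -(image_comp f u) gf.
rewrite vol_sub_simplex /idq_lower_bound -bin2_half.
have suml : \sum_i l i = n%:R.
  rewrite -(mxtrace1 R n) I1 -/(outer_sum l u) mxtrace_outer_sum.
  by apply: eq_bigr => i _; rewrite u1 expr1n mulr1.
have N0 : 0 < 'C(n.+1, 2)%:R :> R by rewrite ltr0n bin_gt0.
have ratio : n%:R / 'C(n.+1, 2)%:R = (n.+1%:R / 2)^-1 :> R.
  have n1 : n%:R != 0 :> R by rewrite pnatr_eq0 -lt0n.
  have n2 : n.+1%:R != 0 :> R by rewrite pnatr_eq0.
  by rewrite natr_bin2S; move: (n%:R : R) (n.+1%:R : R) n1 n2 => x y x0 y0; field; rewrite x0 y0.
rewrite invfM mulrA ler_pM2r ?invr_gt0 ?ltr0n ?fact_gt0 //.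
rewrite -ler_sqr ?nnegrE ?divr_ge0 ?powR_ge0 ?sqrtr_ge0 //.
rewrite expr_div_n sqr_powR_half ?divr_ge0 // sqr_sqrtr // real_normK ?num_real //.
move: Hf; rewrite suml ratio exprVn; set q := (_ / 2) ^+ n => Hf.
have q0 : 0 < q by rewrite exprn_gt0 // divr_gt0 // ltr0n.
rewrite ler_pdivrMr; last by rewrite ltr0n bin_gt0 binS bin1 leq_addl.
have := ler_wpM2l (ltW q0) Hf; rewrite mulr1 => /le_trans; apply.
have qV : q * q^-1 = 1 by rewrite divff // gt_eqF.
rewrite !mulrA (mulrC q) -(mulrA _ q) qV mulr1.
by rewrite -mulrA -expr2 mulrC.
Qed.

Lemma DR_le_idq n (K : set 'rV[R]_n) : (0 < n)%N -> convex_body K ->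
  behrend_position K -> DR R 'C(n.+1, 2) n n <= idq K.
Proof.
move=> n0 bK behr; apply: ge_sup (DR_bounds_le_idq n0 bK behr).
by exists (idq_lower_bound R n); exact: idq_lower_bound_DR_bounds.
Qed.

(** Here [idq K] shows that the set defining [DR] is bounded above, so that its supremum dominates
    its members. *)
Lemma idq_lower_bound_le_DR n (K : set 'rV[R]_n) : (0 < n)%N -> convex_body K ->
  behrend_position K -> idq_lower_bound R n <= DR R 'C(n.+1, 2) n n.
Proof.
move=> n0 bK behr; apply: ub_le_sup (idq_lower_bound_DR_bounds n0).
by exists (idq K); exact: DR_bounds_le_idq.
Qed.

(** Both squares are equal: 2^3 / (20 * 36) = 10 / 900. *)
Lemma idq_lower_bound3 : idq_lower_bound R 3 = Num.sqrt 10 / 30.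
Proof.
apply/eqP; rewrite -(@eqrXn2 _ 2) //.
- rewrite /idq_lower_bound !expr_div_n exprMn sqr_powR_half // !sqr_sqrtr //.
  have -> : 'C((3 * 4) %/ 2, 3) = 20%N by [].
  have -> : 3`! = 6%N by [].
  by apply/eqP; field.
- by rewrite divr_ge0 ?powR_ge0 // mulr_ge0 ?sqrtr_ge0.
Qed.

End identity_decompositions.

(** * The formulas of Wallis and Stirling *)

Section wallis.
Context {R : realType}.
Local Notation leb := (@lebesgue_measure R).

Lemma is_derive_continuous (f : R -> R) (x df : R) : is_derive x 1 f df ->
  {for x, continuous f}.
Proof.
by move=> dx; apply: differentiable_continuous; apply/derivable1_diffP; exact: ex_derive.
Qed.

Lemma Rintegral_derive (F f : R -> R) (a b : R) : a < b ->
  (forall x : R, is_derive x 1 F (f x)) -> continuous f ->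
  \int[leb]_(x in `[a, b]) f x = F b - F a.
Proof.
move=> ab dF cf; have cF x : {for x, continuous F} by exact: is_derive_continuous.
rewrite /Rintegral (@continuous_FTC2 _ f F) //.
- exact: continuous_subspaceT.
- split; first by move=> x _; exact: ex_derive.
  + by apply: cvg_at_right_filter; exact: cF.
  + by apply: cvg_at_left_filter; exact: cF.
- by move=> x _; rewrite derive1E derive_val.
Qed.

Definition sin_integral k : R := \int[leb]_(x in `[0, pi / 2]) (sin x ^+ k).

Lemma continuous_sinX k : continuous (fun x : R => sin x ^+ k).
Proof.
by move=> x; exact: (continuous_comp (@continuous_sin R x) (@exprn_continuous R k _)).
Qed.

Lemma integrable_sinX k : leb.-integrable `[0, pi / 2] (EFin \o (fun x : R => sin x ^+ k)).
Proof.
apply: continuous_compact_integrable; first exact: segment_compact.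
by apply: continuous_subspaceT; exact: continuous_sinX.
Qed.

Lemma pi2_gt0 : 0 < pi / 2 :> R. Proof. by rewrite divr_gt0 // pi_gt0. Qed.

Lemma sin_integral0 : sin_integral 0 = pi / 2.
Proof.
rewrite /sin_integral; under eq_Rintegral do rewrite expr0.
rewrite Rintegral_cst //= lebesgue_measure_itv /= lte_fin pi2_gt0.
by rewrite sube0 mul1r.
Qed.

Lemma sin_integral1 : sin_integral 1 = 1.
Proof.
have dF (x : R) : is_derive x 1 (fun x => - cos x) (sin x ^+ 1).
  by apply: is_derive_eq; rewrite opprK expr1.
rewrite /sin_integral (Rintegral_derive pi2_gt0 dF (@continuous_sinX 1)).
by rewrite cos_pihalf cos0 oppr0 sub0r opprK.
Qed.

(** Integrate the derivative of sin^(k+1) cos, a function that vanishes at both ends. *)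
Lemma sin_integralSS k : k.+2%:R * sin_integral k.+2 = k.+1%:R * sin_integral k.
Proof.
pose f (x : R) := k.+1%:R * sin x ^+ k - k.+2%:R * sin x ^+ k.+2.
have dX (x : R) : is_derive x 1 (fun x => sin x ^+ k.+1) (k.+1%:R * sin x ^+ k * cos x).
  by have := is_deriveX k.+1 (is_derive_sin x); rewrite exprfctE.
have dF (x : R) : is_derive x 1 (fun x => sin x ^+ k.+1 * cos x) (f x).
  apply: (@is_derive_eq _ _ _ (fun x => sin x ^+ k.+1 * cos x)).
  rewrite /GRing.scale /f /=.
  have s2 : sin x ^+ 2 = 1 - cos x ^+ 2 by rewrite -(cos2Dsin2 x); ring.
  transitivity (k.+1%:R * sin x ^+ k * cos x ^+ 2 - sin x ^+ k * sin x ^+ 2).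
    by rewrite exprS; ring.
  have -> : sin x ^+ k.+2 = sin x ^+ k * sin x ^+ 2 by rewrite -addn2 exprD.
  by rewrite s2 -!natr1; ring.
have cf : continuous f.
  move=> x; apply: cvgB; apply: cvgM; try exact: cvg_cst; exact: continuous_sinX.
have := Rintegral_derive pi2_gt0 dF cf.
rewrite cos_pihalf sin0 mulr0 expr0n mul0r subr0.
have iX (m j : nat) : leb.-integrable `[0, pi / 2] (EFin \o (fun x : R => m%:R * sin x ^+ j)).
  apply: continuous_compact_integrable; first exact: segment_compact.
  apply: continuous_subspaceT => x; apply: cvgM; first exact: cvg_cst.
  exact: continuous_sinX.
rewrite RintegralB // !RintegralZl //; last 2 first.
- exact: integrable_sinX.
- exact: integrable_sinX.
by move/eqP; rewrite subr_eq0 eq_sym => /eqP.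
Qed.

Lemma sin_integral_nonincreasing k : sin_integral k.+1 <= sin_integral k.
Proof.
apply: le_Rintegral => //; try exact: integrable_sinX.
move=> x; rewrite /= in_itv /= => /andP[x0 x1].
have s0 : 0 <= sin x.
  apply: sin_ge0_pi; rewrite x0 (le_trans x1) // ler_pdivrMr // ler_peMr ?ler1n //.
  by rewrite ltW // pi_gt0.
by rewrite exprS ler_piMl ?exprn_ge0 // sin_le1.
Qed.

(** Equal to the Wallis product of (2 i - 1) / (2 i) over 1 <= i <= n. *)
Definition central_ratio n : R := 'C(n.*2, n)%:R / 4 ^+ n.

Lemma central_ratioS n : n.+1.*2%:R * central_ratio n.+1 = n.*2.+1%:R * central_ratio n.
Proof.
rewrite /central_ratio exprS.
have H : (n.+1 * 'C(n.+1.*2, n.+1) = 2 * n.*2.+1 * 'C(n.*2, n))%N.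
  have E : (n.*2.+1 - n = n.+1)%N by rewrite -addnn subSn ?leq_addr // addnK.
  by rewrite -mul_bin_diag -mulnA (mul_bin_down n.*2.+1 n) E mulnA mul2n.
have := congr1 (fun m => m%:R : R) H; rewrite /= !natrM => H'.
have e4 : 4 ^+ n != 0 :> R by rewrite expf_neq0.
have -> : n.+1.*2%:R = n.+1%:R * 2 :> R by rewrite -muln2 natrM.
rewrite mulrA (mulrAC _ 2) H'; move: (4 ^+ n) e4 => e e0; field.
by rewrite e0.
Qed.

Lemma central_ratio_gt0 n : 0 < central_ratio n.
Proof. by rewrite divr_gt0 ?exprn_gt0 // ltr0n bin_gt0 -addnn leq_addr. Qed.

Lemma sin_integral_even n : sin_integral n.*2 = pi / 2 * central_ratio n.
Proof.
elim: n => [|n IH].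
  by rewrite sin_integral0 /central_ratio bin0 expr0 divr1 mulr1.
have := sin_integralSS n.*2; rewrite IH mulrCA -central_ratioS.
rewrite -doubleS mulrCA => /mulfI; apply; by rewrite pnatr_eq0.
Qed.

Lemma sin_integral_odd n : n.*2.+1%:R * sin_integral n.*2.+1 * central_ratio n = 1.
Proof.
elim: n => [|n IH].
  by rewrite sin_integral1 /central_ratio bin0 expr0 divr1 !mulr1.
rewrite -[RHS]IH doubleS (sin_integralSS n.*2.+1) -doubleS.
by rewrite mulrAC central_ratioS mulrAC.
Qed.

(** The integral of index 2n lies between those of indices 2n + 1 and 2n - 1, and the recurrence
    expresses all three through [central_ratio n]. *)
Lemma wallis_bounds n : (0 < n)%N ->
  pi <= (n%:R * central_ratio n ^+ 2)^-1 <= pi * (1 + (n.*2%:R)^-1).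
Proof.
move=> n0; have p0 := central_ratio_gt0 n; set p := central_ratio n in p0 *.
have nR : 0 < n%:R :> R by rewrite ltr0n.
have odd1 := sin_integral_odd n; have even1 := sin_integral_even n; rewrite -/p in odd1 even1.
have le1 : 1 <= n.*2.+1%:R * (pi / 2 * p) * p.
  rewrite -[leLHS]odd1 ler_pM2r // ler_pM2l ?ltr0n // -even1.
  exact: sin_integral_nonincreasing.
have le2 : n.*2%:R * (pi / 2 * p) * p <= 1.
  rewrite -[leRHS]odd1 ler_pM2r // -even1.
  have := sin_integralSS n.*2.-1; have -> : (n.*2.-1.+2 = n.*2.+1)%N by case: (n) n0.
  have n2 : (n.*2.-1.+1 = n.*2)%N by case: (n) n0.
  rewrite n2 => ->; rewrite ler_pM2l ?ltr0n ?double_gt0 //.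
  by have := sin_integral_nonincreasing n.*2.-1; rewrite n2.
have n2E : n.*2%:R = 2 * n%:R :> R by rewrite -muln2 natrM mulrC.
have np : 0 < n%:R * p ^+ 2 by rewrite mulr_gt0 // exprn_gt0.
apply/andP; split.
  rewrite -[leRHS]mul1r ler_pdivlMr //; apply: le_trans le2.
  by rewrite n2E le_eqVlt; apply/orP; left; apply/eqP; field.
rewrite -[leLHS]mul1r ler_pdivrMr //; apply: le_trans le1 _.
rewrite -natr1 n2E le_eqVlt; apply/orP; left; apply/eqP; field.
by rewrite gt_eqF.
Qed.

Lemma wallis : (n%:R * central_ratio n ^+ 2)^-1 @[n --> \oo] --> (pi : R).
Proof.
apply: (@squeeze_cvgr _ _ _ _ (fun=> pi) (fun n => pi * (1 + harmonic n))).
- exists 1%N => // n /= n0; have /andP[-> H] := wallis_bounds n0.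
  apply: (le_trans H); rewrite ler_pM2l ?pi_gt0 // lerD2l /harmonic /=.
  rewrite lef_pV2 ?posrE ?ltr0n ?double_gt0 // ler_nat -addnn -addn1 leq_add2l //.
- exact: cvg_cst.
- have : pi * (1 + harmonic n) @[n --> \oo] --> (pi * (1 + 0) : R).
    apply: cvgM; first exact: cvg_cst.
    by apply: cvgD; [exact: cvg_cst|exact: cvg_harmonic].
  by rewrite addr0 mulr1.
Qed.

End wallis.

Section stirling.
Context {R : realType}.

Lemma nondecreasing_from1 (f df : R -> R) (y : R) :
  (forall x : R, 0 < x -> is_derive x 1 f (df x)) -> (forall x : R, 1 <= x -> 0 <= df x) ->
  1 <= y -> f 1 <= f y.
Proof.
move=> fd df0 y1.
apply: (@ger0_derive1_le_cc _ f 1 y) => //.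
- move=> x; rewrite in_itv /= => /andP[x1 _].
  by have [] := fd x (lt_trans ltr01 x1).
- move=> x; rewrite in_itv /= => /andP[x1 _].
  have x0 := lt_trans ltr01 x1; have := fd x x0 => dx.
  by rewrite derive1E derive_val df0 // ltW.
- apply: continuous_in_subspaceT => x; rewrite inE /= in_itv /= => /andP[x1 _].
  exact: is_derive_continuous (fd x (lt_le_trans ltr01 x1)).
- by rewrite in_itv /= lexx.
- by rewrite in_itv /= lexx andbT.
Qed.

(** The two sides agree at 1 and their difference has derivative ln x + 1/x - 1 >= 0. This bound and
    the next agree with ln to second order at 1. *)
Lemma ln_lower_bound (y : R) : 1 <= y -> 2 * (y - 1) <= (y + 1) * ln y.
Proof.
move=> y1; rewrite -subr_ge0.
have := @nondecreasing_from1 (fun x => (x + 1) * ln x - 2 * (x - 1))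
  (fun x => ln x + (x + 1) / x - 2) y _ _ y1.
rewrite ln1 mulr0 subrr mulr0 subrr; apply => x x0.
  have dl := is_derive1_ln x0; apply: is_derive_eq.
  by rewrite /GRing.scale /=; ring.
have {}x0 : 0 < x by exact: lt_le_trans x0.
have := @le_ln1Dx R (x^-1 - 1); rewrite subrKC lnV ?posrE // ltrBrDr addNr invr_gt0 => /(_ x0).
by rewrite mulrDl divff ?gt_eqF // mul1r; lra.
Qed.

Lemma ln_upper_bound (y : R) : 1 <= y -> 2 * (y * ln y) <= y ^+ 2 - 1.
Proof.
move=> y1; rewrite -subr_ge0.
have := @nondecreasing_from1 (fun x => x * x - 1 - 2 * (x * ln x))
  (fun x => 2 * (x - 1 - ln x)) y _ _ y1.
rewrite ln1 mulr0 mulr0 mulr1 subrr subrr expr2; apply => x x0.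
  have dl := is_derive1_ln x0; apply: is_derive_eq.
  have xV : x * x^-1 = 1 by rewrite divff // gt_eqF.
  by rewrite /GRing.scale /= xV; ring.
have := @le_ln1Dx R (x - 1); rewrite subrKC; lra.
Qed.

(** For positive n, the logarithm of n! divided by n^n e^(-n) sqrt n. *)
Definition stirling_log n : R := ln (n`!%:R) + n%:R - (n%:R + 2^-1) * ln (n%:R).

(** The difference is (n + 1/2) ln y - 1 with y = 1 + 1/n, to which the two bounds on ln apply. The
    upper bound telescopes, which bounds the decreasing sequence from below. *)
Lemma stirling_log_diff n : (0 < n)%N ->
  0 <= stirling_log n - stirling_log n.+1 <= 4^-1 * (n%:R^-1 - n.+1%:R^-1).
Proof.
move=> n0; have nR : 0 < n%:R :> R by rewrite ltr0n.
have n1R : 0 < n.+1%:R :> R by rewrite ltr0n.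
pose y : R := n.+1%:R / n%:R.
have y1 : 1 <= y by rewrite ler_pdivlMr // mul1r ler_nat.
have -> : stirling_log n - stirling_log n.+1 = (n%:R + 2^-1) * ln y - 1.
  rewrite /stirling_log factS natrM lnM ?posrE ?ltr0n ?fact_gt0 // ln_div ?posrE //.
  by rewrite -natr1; ring.
have nE : n.+1%:R = n%:R + 1 :> R by rewrite natr1.
have lo := ln_lower_bound y1; have up := ln_upper_bound y1.
have y1E : y - 1 = n%:R^-1 by rewrite /y nE; field; rewrite gt_eqF.
apply/andP; split.
  rewrite subr_ge0.
  have nV : 0 < n%:R^-1 :> R by rewrite invr_gt0.
  have : 2 * n%:R^-1 <= 2 * ((n%:R + 2^-1) * ln y) * n%:R^-1.
    apply: (le_trans _ (le_trans lo _)); first by rewrite y1E.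
    rewrite le_eqVlt; apply/orP; left; apply/eqP.
    have -> : y = 1 + n%:R^-1 by rewrite -y1E; ring.
    by field; rewrite gt_eqF.
  by rewrite (ler_pM2r nV) -[X in X <= _]mulr1 ler_pM2l.
rewrite lerBlDl.
have y0 : 0 < y by rewrite divr_gt0.
have y20 : 0 < 2 * y by exact: mulr_gt0.
move: up; rewrite mulrA -(ler_pdivlMl _ _ y20) => up.
have h0 : 0 < n%:R + 2^-1 :> R by rewrite addr_gt0.
apply: (le_trans (ler_wpM2l (ltW h0) up)).
rewrite le_eqVlt; apply/orP; left; apply/eqP; rewrite /y.
clear -nE nR n1R; move: (n%:R : R) (n.+1%:R : R) nE nR n1R => a b -> a0 b0.
by field; rewrite !gt_eqF.
Qed.

End stirling.

Section stirling_limit.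
Context {R : realType}.

Lemma stirling_log_cvg : exists l : R, @stirling_log R n @[n --> \oo] --> l.
Proof.
pose u (n : nat) : R := stirling_log n.+1.
have ud : nonincreasing_seq u.
  apply/nonincreasing_seqP => n; rewrite -subr_ge0.
  by have /andP[] := @stirling_log_diff R n.+1 (ltn0Sn n).
have ub n : u 0%N - 4^-1 * (1 - n.+1%:R^-1) <= u n.
  elim: n => [|n IH]; first by rewrite invr1 subrr mulr0 subr0.
  have /andP[_ H] := @stirling_log_diff R n.+1 (ltn0Sn n).
  move: IH H; rewrite -/(u n) -/(u n.+1).
  by move: (u n) (u n.+1) (u 0%N) (n.+1%:R^-1 : R) (n.+2%:R^-1 : R) => a b c d e; lra.
have uc : cvgn u.
  apply: nonincreasing_is_cvgn => //; exists (u 0%N - 4^-1) => _ [n _ <-].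
  apply: le_trans (ub n); rewrite lerB // ler_piMr // gerBl invr_ge0 //.
exists (limn u); rewrite -(cvg_shiftS (@stirling_log R)); exact: uc.
Qed.

(** The factorials combine into a central binomial coefficient, so Wallis' product determines the
    limit of this expression. *)
Lemma stirling_log_double n : (0 < n)%N ->
  2 * stirling_log n - stirling_log n.*2 =
  2^-1 * (ln 2 + ln (n%:R * central_ratio n ^+ 2)^-1) :> R.
Proof.
move=> n0; have nR : 0 < n%:R :> R by rewrite ltr0n.
have p0 := @central_ratio_gt0 R n.
have fE : (n.*2)`!%:R = 'C(n.*2, n)%:R * n`!%:R ^+ 2 :> R.
  have := @bin_fact n.*2 n; rewrite -addnn leq_addr addnK => /(_ isT) <-.
  by rewrite !natrM expr2 !mulrA.
have C0 : 0 < 'C(n.*2, n)%:R :> R by rewrite ltr0n bin_gt0 -addnn leq_addr.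
have f0 : 0 < n`!%:R :> R by rewrite ltr0n fact_gt0.
have n2E : n.*2%:R = 2 * n%:R :> R by rewrite -muln2 natrM mulrC.
rewrite /stirling_log fE lnM ?posrE ?exprn_gt0 // lnXn // n2E [ln (2 * _)]lnM ?posrE //.
rewrite lnV ?posrE ?mulr_gt0 ?exprn_gt0 // lnM ?posrE ?exprn_gt0 // lnXn //.
rewrite /central_ratio ln_div ?posrE ?exprn_gt0 //.
have -> : 4 ^+ n = 2 ^+ (2 * n) :> R by rewrite exprM; congr (_ ^+ _); ring.
rewrite [ln (2 ^+ _)]lnXn // -[ln 2 *+ _]mulr_natr natrM.
set a := ln n`!%:R; set b := ln n%:R; set c := ln 'C(_, _)%:R; set d := ln 2; set x := n%:R.
by field.
Qed.

Lemma stirling : @stirling_log R n @[n --> \oo] --> 2^-1 * ln (2 * pi).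
Proof.
have [l Sl] := stirling_log_cvg.
have S2l : @stirling_log R n.*2 @[n --> \oo] --> l.
  apply: (@cvg_comp _ _ _ double (@stirling_log R) _ \oo _ _ Sl).
  move=> A [N _ NA]; exists N => // n /= Nn; apply: NA => /=.
  by rewrite (leq_trans Nn) // -addnn leq_addr.
(* Both terms have limits expressed by the same [l], so this combination tends to [l] itself. *)
have H : (2 * stirling_log n - stirling_log n.*2) @[n --> \oo] --> 2 * l - l.
  by apply: cvgB => //; apply: cvgM => //; exact: cvg_cst.
have H' : (2 * stirling_log n - stirling_log n.*2) @[n --> \oo] --> (2^-1 * (ln 2 + ln pi) : R).
  apply: (@cvg_trans _ ((2^-1 * (ln 2 + ln (n%:R * central_ratio n ^+ 2)^-1)) @[n --> \oo])).
    apply: near_eq_cvg; exists 1%N => // n /= n0; exact/esym/stirling_log_double.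
  apply: cvgM; first exact: cvg_cst.
  apply: cvgD; first exact: cvg_cst.
  apply: (cvg_comp _ _ (@wallis R)); exact: continuous_ln (pi_gt0 R).
have := cvg_unique _ H H'; rewrite -lnM ?posrE ?pi_gt0 // => /(_ (@norm_hausdorff _ _)).
move=> E; suff <- : l = 2^-1 * ln (2 * pi) by [].
by rewrite -E; ring.
Qed.

End stirling_limit.

(** * Asymptotics of the lower bound *)

Section asymptotics.
Context {R : realType}.

Definition falling_ratio N n : R := \prod_(i < n) (1 - i%:R / N%:R).

Lemma sum_ord_natr n : \sum_(i < n) i%:R = n%:R * (n%:R - 1) / 2 :> R.
Proof.
elim: n => [|n IH]; first by rewrite big_ord0 !mul0r.
by rewrite big_ord_recr /= IH -natr1; field.
Qed.

Lemma ffact_falling_ratio N n : (n <= N)%N -> (0 < N)%N ->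
  (N ^_ n)%:R = N%:R ^+ n * falling_ratio N n :> R.
Proof.
move=> nN N0; rewrite ffact_prod natr_prod /falling_ratio.
rewrite -[X in _ ^+ X](card_ord n) -prodr_const -big_split /=; apply: eq_bigr => i _.
rewrite natrB; last by rewrite ltnW // (leq_trans (ltn_ord i)).
by rewrite mulrBr mulr1 mulrCA divff ?mulr1 // pnatr_eq0 -lt0n.
Qed.

Lemma falling_ratio_gt0 N n : (n <= N)%N -> 0 < falling_ratio N n.
Proof.
move=> nN; apply: prodr_gt0 => i _; have iN := leq_trans (ltn_ord i) nN.
by rewrite subr_gt0 ltr_pdivrMr ?mul1r ?ltr_nat // ltr0n (leq_ltn_trans _ iN).
Qed.

(** Each factor is estimated by 1 - x <= exp (-x). *)
Lemma falling_ratio_le N n : (n <= N)%N ->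
  falling_ratio N n <= expR (- (n%:R * (n%:R - 1) / 2 / N%:R)).
Proof.
move=> nN; rewrite -sum_ord_natr mulr_suml -sumrN expR_sum; apply: ler_prod => i _.
have iN := leq_trans (ltn_ord i) nN.
rewrite subr_ge0 ler_pdivrMr ?mul1r ?ler_nat ?(ltnW iN) //=; last first.
  by rewrite ltr0n (leq_ltn_trans _ iN).
exact: expR_ge1Dx.
Qed.

(** For i <= n, 1 - i/N is at least the inverse of 1 + i/(N - n), hence at least exp (- i/(N -
    n)). *)
Lemma falling_ratio_ge N n : (n < N)%N ->
  expR (- (n%:R * (n%:R - 1) / 2 / (N%:R - n%:R))) <= falling_ratio N n.
Proof.
move=> nN; rewrite -sum_ord_natr mulr_suml -sumrN expR_sum; apply: ler_prod => i _.
rewrite expR_ge0 /= expRN.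
have M0 : 0 < N%:R - n%:R :> R by rewrite subr_gt0 ltr_nat.
have N0 : 0 < N%:R :> R by rewrite ltr0n (leq_ltn_trans _ nN).
have i0 := ler0n R i; have n_i : i%:R <= n%:R :> R by rewrite ler_nat ltnW.
have y0 : 0 < 1 + i%:R / (N%:R - n%:R) :> R by rewrite ltr_wpDr // divr_ge0 // ltW.
apply: (@le_trans _ _ (1 + i%:R / (N%:R - n%:R))^-1).
  by rewrite lef_pV2 ?posrE ?expR_gt0 // expR_ge1Dx.
rewrite -[leLHS]mul1r ler_pdivrMr //.
move: (i%:R : R) (n%:R : R) (N%:R : R) M0 N0 i0 n_i {y0} => x y z M0 N0 x0 xy.
have -> : (1 - x / z) * (1 + x / (z - y)) = 1 + x * (y - x) / (z * (z - y)).
  by field; rewrite !gt_eqF.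
by rewrite lerDl divr_ge0 ?mulr_ge0 ?subr_ge0 // ltW // -subr_gt0.
Qed.

(** For N = n (n + 1) / 2 one has N - n = n (n - 1) / 2, so the lower exponent is exactly -1, while
    the upper one is - (n - 1) / (n + 1). *)
Lemma ln_falling_ratio_bounds n : (1 < n)%N ->
  -1 <= ln (falling_ratio 'C(n.+1, 2) n) <= -1 + 2 / n.+1%:R.
Proof.
move=> n1; have nN : (n < 'C(n.+1, 2))%N.
  by rewrite binS bin1 -[X in (X < _)%N]add0n ltn_add2r bin_gt0.
have F0 := falling_ratio_gt0 (ltnW nN).
have lo := falling_ratio_ge nN; have up := falling_ratio_le (ltnW nN).
rewrite !natr_bin2S in lo up.
have nR : 1 < n%:R :> R by rewrite ltr1n.
rewrite -(ler_expR (-1)) -(ler_expR _ (-1 + _)) lnK ?posrE //.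
have -> : -1 + 2 / n.+1%:R = - (n%:R * (n%:R - 1) / 2 / (n%:R * n.+1%:R / 2)) :> R.
  by rewrite -[n.+1%:R]natr1; field; rewrite !gt_eqF //; lra.
rewrite up andbT; apply: le_trans lo; rewrite ler_expR lerN2 -[n.+1%:R]natr1.
rewrite (_ : n%:R * (n%:R + 1) / 2 - n%:R = n%:R * (n%:R - 1) / 2 :> R); last by field.
rewrite divff // !mulf_neq0 ?invr_neq0 // gt_eqF //; lra.
Qed.

Lemma falling_ratio_cvg : ln (falling_ratio 'C(n.+1, 2) n) @[n --> \oo] --> (-1 : R).
Proof.
apply: (@squeeze_cvgr _ _ _ _ (fun=> -1) (fun n => -1 + 2 * harmonic n)).
- by exists 2 => // n /= n1; exact: ln_falling_ratio_bounds.
- exact: cvg_cst.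
- have : -1 + 2 * harmonic n @[n --> \oo] --> (-1 + 2 * 0 : R).
    apply: cvgD; first exact: cvg_cst.
    by apply: cvgM; [exact: cvg_cst|exact: cvg_harmonic].
  by rewrite mulr0 addr0.
Qed.

(** Doubling the logarithm removes the square roots. The right-hand side groups the terms so that
    Stirling's formula, the limit of the falling ratio and n / (n + 1) --> 1 each make one group
    vanish. *)
Lemma ln_ratio n : (0 < n)%N ->
  0 < idq_lower_bound R n / idq_lower_bound_asymptotic R n /\
  2 * ln (idq_lower_bound R n / idq_lower_bound_asymptotic R n) =
  stirling_log n - 2^-1 * ln (2 * pi) - (1 + ln (falling_ratio 'C(n.+1, 2) n))
  + ln (n%:R / n.+1%:R).
Proof.
move=> n0; have nN : (n <= 'C(n.+1, 2))%N.
  by rewrite binS bin1 -[X in (X <= _)%N]add0n leq_add2r.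
have n1 : 0 < n%:R :> R by rewrite ltr0n.
have m1 : 0 < n.+1%:R :> R by rewrite ltr0n.
have f0 : 0 < n`!%:R :> R by rewrite ltr0n fact_gt0.
have h0 : 0 < n.+1%:R / 2 :> R by rewrite divr_gt0.
have pi2 : 0 < 2 * pi :> R by rewrite mulr_gt0 // pi_gt0.
have N0 : (0 < 'C(n.+1, 2))%N by rewrite bin_gt0.
have F0 := falling_ratio_gt0 nN.
have c0 : 0 < 'C('C(n.+1, 2), n)%:R :> R by rewrite ltr0n bin_gt0.
(* The binomial coefficient is a falling factorial over n!, and its base C(n+1, 2) is n times (n +
   1) / 2. *)
have lnc : ln 'C('C(n.+1, 2), n)%:R = n%:R * (ln n%:R + ln (n.+1%:R / 2)) +
    ln (falling_ratio 'C(n.+1, 2) n) - ln n`!%:R.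
  have -> : 'C('C(n.+1, 2), n)%:R = (n%:R * (n.+1%:R / 2)) ^+ n *
      falling_ratio 'C(n.+1, 2) n / n`!%:R :> R.
    apply: (mulIf (lt0r_neq0 f0)); rewrite divfK ?gt_eqF // -natrM bin_ffact.
    by rewrite ffact_falling_ratio // natr_bin2S mulrA.
  rewrite ln_div ?posrE ?mulr_gt0 ?exprn_gt0 ?mulr_gt0 //.
  rewrite lnM ?posrE ?exprn_gt0 ?mulr_gt0 // lnXn ?mulr_gt0 // lnM ?posrE //.
  by rewrite -[_ *+ n]mulr_natl.
have ln_sqrt (x : R) : 0 < x -> 2 * ln (Num.sqrt x) = ln x.
  move=> x0; rewrite -[in RHS](sqr_sqrtr (ltW x0)) lnXn ?sqrtr_gt0 //.
  by rewrite mulr_natl.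
have lb0 : 0 < idq_lower_bound R n.
  rewrite /idq_lower_bound -bin2_half divr_gt0 ?powR_gt0 // mulr_gt0 // sqrtr_gt0 //.
have as0 : 0 < idq_lower_bound_asymptotic R n.
  rewrite /idq_lower_bound_asymptotic !mulr_gt0 ?sqrtr_gt0 ?powR_gt0 ?invr_gt0 //;
    by rewrite ?mulr_gt0 ?invr_gt0 ?expR_gt0 // pi_gt0.
split; first exact: divr_gt0.
have lbE : 2 * ln (idq_lower_bound R n) =
    - (n%:R * ln n%:R) - ln (falling_ratio 'C(n.+1, 2) n) - ln n`!%:R.
  rewrite /idq_lower_bound -bin2_half ln_div ?posrE ?powR_gt0 ?mulr_gt0 ?sqrtr_gt0 //.
  rewrite ln_powR (lnM (x := Num.sqrt _)) ?posrE ?sqrtr_gt0 // mulrBr mulrDr ln_sqrt // lnc.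
  by field.
have asE : 2 * ln (idq_lower_bound_asymptotic R n) =
    1 + 2^-1 * (ln (2 * pi) - ln n%:R) + ln n.+1%:R - 2 * ln n`!%:R - n%:R.
  rewrite /idq_lower_bound_asymptotic.
  have [e0 p0] : 0 < Num.sqrt (expR 1) :> R /\ 0 < (2 * pi / n%:R) `^ (1 / 4) :> R.
    by rewrite sqrtr_gt0 expR_gt0 powR_gt0 // divr_gt0.
  have [s0 q0] : 0 < Num.sqrt n.+1%:R :> R /\ 0 < n`!%:R * expR (n%:R / 2) :> R.
    by rewrite sqrtr_gt0 mulr_gt0 // expR_gt0.
  rewrite (lnM (mulr_gt0 e0 p0) (divr_gt0 s0 q0)) (lnM e0 p0) (ln_div s0 q0).
  rewrite ln_powR (ln_div pi2 n1) (lnM f0 (expR_gt0 _)) expRK.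
  rewrite !mulrDr mulrN ln_sqrt ?expR_gt0 // expRK ln_sqrt //.
  by field.
rewrite ln_div ?posrE // mulrBr lbE asE ln_div ?posrE // /stirling_log.
by field.
Qed.

Lemma idq_lower_bound_equivalent :
  (fun n : nat => idq_lower_bound R n / idq_lower_bound_asymptotic R n)
     @ \oo --> (1 : R).
Proof.
pose L n : R := stirling_log n - 2^-1 * ln (2 * pi) -
  (1 + ln (falling_ratio 'C(n.+1, 2) n)) + ln (n%:R / n.+1%:R).
have L0 : L n @[n --> \oo] --> (0 : R).
  have -> : (0 : R) = 2^-1 * ln (2 * pi) - 2^-1 * ln (2 * pi) - (1 + -1) + ln 1.
    by rewrite ln1; ring.
  apply: cvgD; last first.
    apply: continuous_cvg; first exact: continuous_ln.
    have : 1 - harmonic n @[n --> \oo] --> (1 - 0 : R).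
      by apply: cvgB; [exact: cvg_cst|exact: cvg_harmonic].
    rewrite subr0; apply: cvg_trans; apply: near_eq_cvg; apply: nearW => n /=.
    have n1 : n.+1%:R != 0 :> R by rewrite pnatr_eq0.
    by apply: (mulIf n1); rewrite divfK // mulrBl mulVf // mul1r -natr1 addrK.
  apply: cvgB; last by apply: cvgD; [exact: cvg_cst|exact: falling_ratio_cvg].
  by apply: cvgB; [exact: stirling|exact: cvg_cst].
have E : expR (2^-1 * L n) @[n --> \oo] --> (1 : R).
  suff : expR (2^-1 * L n) @[n --> \oo] --> expR (0 : R) by rewrite expR0.
  apply: continuous_cvg; first exact: continuous_expR.
  have : 2^-1 * L n @[n --> \oo] --> (2^-1 * 0 : R).
    by apply: cvgM; [exact: cvg_cst|exact: L0].
  by rewrite mulr0.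
apply: cvg_trans E; apply: near_eq_cvg; exists 1%N => // n /= n0.
have [r0 rE] := ln_ratio n0.
by rewrite /L -rE mulrA mulVf // mul1r lnK.
Qed.

End asymptotics.

Theorem corollary4p7 (R : realType) :
  (forall (n : nat) (K : set 'rV[R]_n),
     (0 < n)%N -> convex_body K -> behrend_position K ->
     DR R 'C(n.+1, 2) n n <= idq K /\
     idq_lower_bound R n <= DR R 'C(n.+1, 2) n n) /\
  ((fun n : nat => idq_lower_bound R n / idq_lower_bound_asymptotic R n)
     @ \oo --> (1 : R)) /\
  (forall K : set 'rV[R]_3,
     convex_body K -> behrend_position K -> Num.sqrt 10 / 30 <= idq K).
Proof.
split; last split.
- move=> n K n0 bK behr.
  by split; [exact: DR_le_idq|exact: (idq_lower_bound_le_DR n0 bK behr)].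
- exact: idq_lower_bound_equivalent.
- move=> K bK behr; rewrite -idq_lower_bound3.
  exact: le_trans (idq_lower_bound_le_DR (isT : (0 < 3)%N) bK behr) (DR_le_idq _ bK behr).
Qed.
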